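(* Transformers (even with two layers) do not admit non-asymptotic length generalization: the length complexity of transformers, viewed as representations of the languages they accept, is not bounded by any computable function, and this holds already for transformers of depth two.
   Context: For integers $p,s$, $\mathbb F=\mathbb F_{p,s}$ is the set of rationals $m\cdot 2^{-s}$ with $m\in\mathbb Z$, $-2^{p-1}\le m<2^{p-1}$; $\mathrm{round}(x)$ is the greatest element of $\mathbb F$ that is $\le x$. A (future-masked) transformer of depth $k$ and dimension $d$ over a finite alphabet $\Sigma$ consists of functions $E:\Sigma\to\mathbb F^d$, $W_Q^{(\ell)},W_K^{(\ell)},W_V^{(\ell)},f^{(\ell)}:\mathbb F^d\to\mathbb F^d$ ($\ell=1,\dots,k$) and $W_{\mathrm{out}}:\mathbb F^d\to\mathbb F$. On input $w$: $h^{(0)}_i=E(w_i)$; for $\ell=1,\dots,k$: $q_i=W_Q^{(\ell)}(h^{(\ell-1)}_i)$, $k_i=W_K^{(\ell)}(h^{(\ell-1)}_i)$, $v_i=W_V^{(\ell)}(h^{(\ell-1)}_i)$, $s_{ij}=q_i\cdot k_j$, $A_i=\sum_{j\le i}\mathrm{round}(\exp(s_{ij}))\,v_j$, $B_i=\sum_{j\le i}\mathrm{round}(\exp(s_{ij}))$ (these sums computed exactly), $c_i=\mathrm{round}(A_i/B_i)$ (or the average of the $v_j$ if $B_i=0$), $h^{(\ell)}_i=f^{(\ell)}(c_i+h^{(\ell-1)}_i)$; finally $T(w)=W_{\mathrm{out}}(h^{(k)}_{|w|})$, and $T$ accepts $w$ iff $T(w)>0$. The size of a transformer is measured with constants in binary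 and precision in unary. The length complexity is $f(c)=\max\{\min\{|w|: w\in L(E)\setminus L(E')\}: E,E' \text{ of size}\le c,\ L(E)\setminus L(E')\ne\emptyset\}$, where $L(E)$ is the language accepted by $E$; admitting non-asymptotic length generalization means that $f$ has a computable upper bound. *)

(* Defs.v *)
From Stdlib Require Import Reals ZArith List Lia.
Import ListNotations.
Open Scope R_scope.

Inductive prf : Type :=
| PZero : prf
| PSucc : prf
| PProj : nat -> prf
| PComp : prf -> list prf -> prf
| PRec  : prf -> prf -> prf
| PMu   : prf -> prf.

Inductive peval : prf -> list nat -> nat -> Prop :=
| ev_zero xs : peval PZero xs 0
| ev_succ x xs : peval PSucc (x :: xs) (S x)
| ev_proj i xs : (i < length xs)%nat -> peval (PProj i) xs (nth i xs 0%nat)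
| ev_comp f gs xs ys y :
    Forall2 (fun g y => peval g xs y) gs ys -> peval f ys y -> peval (PComp f gs) xs y
| ev_rec0 f g xs y : peval f xs y -> peval (PRec f g) (0%nat :: xs) y
| ev_recS f g n xs y z :
    peval (PRec f g) (n :: xs) y -> peval g (n :: y :: xs) z ->
    peval (PRec f g) (S n :: xs) z
| ev_mu f n xs :
    peval f (n :: xs) 0%nat ->
    (forall m, (m < n)%nat -> exists k, peval f (m :: xs) (S k)) ->
    peval (PMu f) xs n.

Definition computable (g : nat -> nat) : Prop :=
  exists c : prf, forall n, peval c [n] (g n).

(* Fixed-point numbers F_{p,s}: an element m * 2^{-s} is stored as its *)
(* integer mantissa m, with -2^{p-1} <= m < 2^{p-1}.                  *)

Definition fp_lo (p : nat) : Z := (- 2 ^ (Z.of_nat p - 1))%Z.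
Definition fp_hi (p : nat) : Z := (2 ^ (Z.of_nat p - 1) - 1)%Z.

Definition in_F (p : nat) (m : Z) : Prop := (fp_lo p <= m <= fp_hi p)%Z.

Definition fval (s : Z) (m : Z) : R := IZR m * powerRZ 2 (- s).

Definition clampZ (p : nat) (z : Z) : Z := Z.max (fp_lo p) (Z.min (fp_hi p) z).

(* round x = greatest element of F that is <= x (mantissa returned);
   Int_part is the floor.  (For x below min F, which never occurs for the
   quantities rounded below, the convention is min F.) *)
Definition fround (p : nat) (s : Z) (x : R) : Z :=
  clampZ p (Int_part (x * powerRZ 2 s)).

Definition sumR (l : list R) : R := fold_right Rplus 0 l.
Definition sumZ (l : list Z) : Z := fold_right Z.add 0%Z l.
Definition sumN (l : list nat) : nat := fold_right Nat.add 0%nat l.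

Definition dotR (s : Z) (u v : list Z) : R :=
  sumR (map (fun '(a, b) => fval s a * fval s b) (combine u v)).

Definition in_Fvec (p d : nat) (v : list Z) : Prop :=
  length v = d /\ Forall (in_F p) v.

Record layer : Type := {
  WQ : list Z -> list Z;
  WK : list Z -> list Z;
  WV : list Z -> list Z;
  FF : list Z -> list Z }.

Record transformer : Type := {
  tp : nat;
  ts : Z;
  td : nat;
  temb : nat -> list Z;
  tlayers : list layer;
  tout : list Z -> Z }.

Definition depth (T : transformer) : nat := length (tlayers T).

Definition word (nsym : nat) (w : list nat) : Prop := Forall (fun a => (a < nsym)%nat) w.

Definition wf_transformer (nsym : nat) (T : transformer) : Prop :=
  (1 <= tp T)%nat /\
  (forall a, (a < nsym)%nat -> in_Fvec (tp T) (td T) (temb T a)) /\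
  (forall L, In L (tlayers T) -> forall x, in_Fvec (tp T) (td T) x ->
      in_Fvec (tp T) (td T) (WQ L x) /\ in_Fvec (tp T) (td T) (WK L x) /\
      in_Fvec (tp T) (td T) (WV L x) /\ in_Fvec (tp T) (td T) (FF L x)) /\
  (forall x, in_Fvec (tp T) (td T) x -> in_F (tp T) (tout T x)).

Definition layer_apply (p : nat) (s : Z) (d : nat) (L : layer)
    (hs : list (list Z)) : list (list Z) :=
  map (fun i =>
    let hi := nth i hs nil in
    let q := WQ L hi in
    let pre := firstn (S i) hs in
    let ws := map (fun hj => fround p s (exp (dotR s q (WK L hj)))) pre in
    let vs := map (WV L) pre in
    let Bm := sumZ ws in
    (* A_i / B_i = (sum_j w_j v_j) / (sum_j w_j); the common factor 2^{-s}
       of the weights cancels *)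
    let c := map (fun a =>
        if Z.eqb Bm 0
        then fround p s (sumR (map (fun v => fval s (nth a v 0%Z)) vs) / INR (S i))
        else fround p s (sumR (map (fun '(w, v) => IZR w * fval s (nth a v 0%Z))
                                   (combine ws vs)) / IZR Bm))
      (seq 0 d) in
    FF L (map (fun a => clampZ p (nth a c 0%Z + nth a hi 0%Z)) (seq 0 d)))
  (seq 0 (length hs)).

Definition run (T : transformer) (w : list nat) : list (list Z) :=
  fold_left (fun hs L => layer_apply (tp T) (ts T) (td T) L hs)
            (tlayers T) (map (temb T) w).

Definition accepts (T : transformer) (w : list nat) : Prop :=
  w <> nil /\ (0 < tout T (last (run T w) nil))%Z.

(* Size: precision p and |s| in unary, constants in binary.            *)
(* A function F^d -> F^d is given by its table of constants.           *)

Definition F_elems (p : nat) : list Z :=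
  map (fun k => (fp_lo p + Z.of_nat k)%Z) (seq 0 (2 ^ p)).

Fixpoint F_vecs (p d : nat) : list (list Z) :=
  match d with
  | O => [nil]
  | S d' => flat_map (fun v => map (fun x => x :: v) (F_elems p)) (F_vecs p d')
  end.

(* binary length of an integer constant (sign bit + magnitude bits) *)
Definition bitsZ (m : Z) : nat := S (Z.to_nat (Z.log2 (Z.abs m) + 1)).
Definition bitsV (v : list Z) : nat := sumN (map bitsZ v).

Definition table_size (p d : nat) (f : list Z -> list Z) : nat :=
  sumN (map (fun x => bitsV (f x)) (F_vecs p d)).

Definition tsize (nsym : nat) (T : transformer) : nat :=
  let p := tp T in let d := td T in
  (p + Z.abs_nat (ts T) + d + depth T
   + sumN (map (fun a => bitsV (temb T a)) (seq 0 nsym))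
   + sumN (map (fun L => table_size p d (WQ L) + table_size p d (WK L)
                         + table_size p d (WV L) + table_size p d (FF L))
               (tlayers T))
   + sumN (map (fun x => bitsZ (tout T x)) (F_vecs p d)))%nat.

(* Length complexity (of the class of depth-k transformers over the    *)
(* alphabet {0..nsym-1}) is bounded by g:  f(c) <= g(c) for all c,     *)
(* where f(c) = max over E,E' of size <= c with L(E)\L(E') nonempty of *)
(* the minimal length of a word in L(E)\L(E').                         *)

Definition length_complexity_bounded_by (nsym k : nat) (g : nat -> nat) : Prop :=
  forall (c : nat) (E E' : transformer),
    wf_transformer nsym E -> wf_transformer nsym E' ->
    depth E = k -> depth E' = k ->
    (tsize nsym E <= c)%nat -> (tsize nsym E' <= c)%nat ->
    (exists w, word nsym w /\ accepts E w /\ ~ accepts E' w) ->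
    exists w, word nsym w /\ accepts E w /\ ~ accepts E' w /\ (length w <= g c)%nat.

Definition admits_nonasymptotic_length_generalization (nsym k : nat) : Prop :=
  exists g : nat -> nat, computable g /\ length_complexity_bounded_by nsym k g.

(* Main.v *)
(* Prefix counts of letters can be compared linearly by one uniform attention
   layer, and a second layer checks that no position has failed.  This suffices
   to accept exactly the traces of a register machine whose whole memory is one
   number A, the registers being the exponents of the primes in A: the step
   relation between (address, A) and its successor is a boolean combination of
   linear (in)equalities, so each step is written as a freely guessed successor
   in unary, a check of the step relation, and a copy back.  The alphabet is
   fixed; only the checks depend on the program.
   If a computable g bounded the length complexity, one could run g o size, with
   size(n) a computable bound on the size of the n-th transformer, on a large
   input n.  The only accepted traces are longer than the final memory, hence
   than g(size(n)). *)
From mathcomp Require ssreflect ssrfun ssrbool eqtype ssrnat div prime choice.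
Require Import Defs.
From Stdlib Require Import Reals ZArith List Lia Lra Bool.
Import ListNotations.
Set Bullet Behavior "Strict Subproofs".

(** * Registers as prime exponents *)

(** The obstacle is that the alphabet is chosen before [g], hence before the program to be
    simulated: separate letters for every register would make it grow with the program. Prime coding
    leaves five unary counters, and the program enters only through the coefficients of the
    inequalities. A bounded-precision head is exact here because only signs are used: a floored
    average of integers is nonnegative exactly when their sum is, and saturation preserves this. The
    price is that the inequalities must be homogeneous and that divisibility needs a guessed
    quotient. The second layer uses the same fact: the average of marks 0 and -1 has a negative
    floor after a single failure, at whatever length. Only one direction of the compilation is
    proved. The compiled program halts, and since the flat code is deterministic, every accepted
    word must reach that same halting memory. No self-reference is needed: the size bound is a
    function of the input [n] alone once [n] is at least the size of the compiled code, which is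
    fixed before [n] is chosen. *)

Module PrimeRegisters.
Import ssreflect ssrfun ssrbool eqtype ssrnat div prime choice.
Local Open Scope nat_scope.

Fixpoint reg_prime (i : nat) : nat :=
  if i is j.+1 then s2val (prime_above (reg_prime j)) else 2.

Lemma reg_prime_prime i : prime (reg_prime i).
Proof. by case: i => [//|i] /=; case: (prime_above _). Qed.

Lemma reg_prime_lt i j : i < j -> reg_prime i < reg_prime j.
Proof.
elim: j => // j IH; rewrite ltnS leq_eqVlt => Hij.
have H : reg_prime j < reg_prime j.+1 by rewrite /=; case: (prime_above _).
case/orP: Hij => [/eqP -> //|/IH Hij]; exact: ltn_trans Hij H.
Qed.

Lemma reg_prime_inj i j : i <> j -> (reg_prime i == reg_prime j) = false.
Proof.
move=> Hij; apply/negP => /eqP E.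
by case: (ltngtP i j) => // /reg_prime_lt; rewrite E ltnn.
Qed.

Definition reg_val (i N : nat) : nat := logn (reg_prime i) N.

Lemma reg_prime_ge2 i : (2 <= reg_prime i)%coq_nat.
Proof. by apply/leP; apply: prime_gt1; exact: reg_prime_prime. Qed.

Lemma reg_val_one i : reg_val i 1 = 0.
Proof. exact: logn1. Qed.

Lemma reg_val_mul_same i N :
  (0 < N)%coq_nat -> reg_val i (Nat.mul (reg_prime i) N) = S (reg_val i N).
Proof.
move/ltP => HN; have Hp := reg_prime_prime i.
by rewrite /reg_val (lognM _ (prime_gt0 Hp) HN) (logn_prime _ Hp) eqxx.
Qed.

Lemma reg_val_mul_other i j N :
  (0 < N)%coq_nat -> i <> j -> reg_val j (Nat.mul (reg_prime i) N) = reg_val j N.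
Proof.
move/ltP => HN Hij; have Hp := reg_prime_prime i.
rewrite /reg_val (lognM _ (prime_gt0 Hp) HN) (logn_prime _ Hp) eq_sym.
by rewrite reg_prime_inj.
Qed.

Lemma reg_val_pos i N :
  (0 < N)%coq_nat -> (0 < reg_val i N)%coq_nat ->
  exists M, N = Nat.mul (reg_prime i) M.
Proof.
move=> _ /ltP; rewrite logn_gt0 mem_primes => /and3P [_ _ /dvdnP [M ->]].
by exists M; rewrite mulnC.
Qed.

(** With [e] the exponent of the prime [p], [p ^ e] divides [N] and exceeds [e]. This turns a large
    output register into a large memory, hence into a long trace. *)
Lemma reg_val_lt i N : (0 < N)%coq_nat -> (reg_val i N < N)%coq_nat.
Proof.
move/ltP => HN; apply/ltP.
have Hp := prime_gt1 (reg_prime_prime i).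
apply: leq_trans (dvdn_leq HN (pfactor_dvdnn (reg_prime i) N)).
exact: ltn_expl.
Qed.
End PrimeRegisters.
Import PrimeRegisters.

(** * While programs computing partial recursive functions *)

Local Open Scope nat_scope.

Inductive cmd : Type :=
| Skip : cmd
| Inc : nat -> cmd
| Dec : nat -> cmd
| Seq : cmd -> cmd -> cmd
| While : nat -> cmd -> cmd.

Definition store := nat -> nat.

Definition upd (s : store) (i x : nat) : store :=
  fun j => if Nat.eqb j i then x else s j.

Lemma upd_same s i x : upd s i x i = x.
Proof. unfold upd. now rewrite Nat.eqb_refl. Qed.

Lemma upd_other s i x j : j <> i -> upd s i x j = s j.
Proof. intros H. unfold upd. apply Nat.eqb_neq in H. now rewrite H. Qed.

Inductive exec : cmd -> store -> store -> Prop :=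
| ex_skip s : exec Skip s s
| ex_inc i s : exec (Inc i) s (upd s i (S (s i)))
| ex_dec i s n : s i = S n -> exec (Dec i) s (upd s i n)
| ex_seq c1 c2 s s1 s2 : exec c1 s s1 -> exec c2 s1 s2 -> exec (Seq c1 c2) s s2
| ex_while0 i c s : s i = 0 -> exec (While i c) s s
| ex_whileS i c s s1 s2 :
    s i <> 0 -> exec c s s1 -> exec (While i c) s1 s2 -> exec (While i c) s s2.

(** Some terminating execution is enough: uniqueness of the result is obtained on the flat code,
    from [zstep_det]. *)
Definition runs (c : cmd) (s : store) (Q : store -> Prop) : Prop :=
  exists s', exec c s s' /\ Q s'.

Lemma runs_weaken c s (Q Q' : store -> Prop) :
  runs c s Q -> (forall s', Q s' -> Q' s') -> runs c s Q'.
Proof. intros [s' [H1 H2]] H. exists s'. auto. Qed.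

Lemma runs_seq c1 c2 s Q : runs c1 s (fun s1 => runs c2 s1 Q) -> runs (Seq c1 c2) s Q.
Proof. intros [s1 [H1 [s2 [H2 H3]]]]. exists s2. split; [econstructor; eauto|auto]. Qed.

Lemma runs_skip s (Q : store -> Prop) : Q s -> runs Skip s Q.
Proof. intros H. exists s. split; [constructor|auto]. Qed.

Lemma runs_inc i s (Q : store -> Prop) : Q (upd s i (S (s i))) -> runs (Inc i) s Q.
Proof. intros H. eexists. split; [constructor|auto]. Qed.

Lemma runs_dec i s n (Q : store -> Prop) : s i = S n -> Q (upd s i n) -> runs (Dec i) s Q.
Proof. intros E H. eexists. split; [constructor; eauto|auto]. Qed.

Lemma runs_while0 i c s (Q : store -> Prop) : s i = 0 -> Q s -> runs (While i c) s Q.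
Proof. intros E H. exists s. split; [now constructor|auto]. Qed.

Lemma runs_whileS i c s Q :
  s i <> 0 -> runs c s (fun s1 => runs (While i c) s1 Q) -> runs (While i c) s Q.
Proof.
  intros E [s1 [H1 [s2 [H2 H3]]]]. exists s2.
  split; [eapply ex_whileS; eauto|auto].
Qed.

Definition clear (r : nat) : cmd := While r (Dec r).

Lemma runs_clear r s :
  runs (clear r) s (fun s' => s' r = 0 /\ forall j, j <> r -> s' j = s j).
Proof.
  remember (s r) as n eqn:E. revert s E.
  induction n as [|n IH]; intros s E.
  - apply runs_while0; auto.
  - apply runs_whileS; [lia|]. eapply runs_dec; [eauto|].
    eapply runs_weaken; [apply IH; now rewrite upd_same|].
    cbv beta. intros s' [H1 H2]. split; auto. intros j Hj. rewrite H2 by auto.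
    now apply upd_other.
Qed.

Definition move2 (a b c : nat) : cmd := While a (Seq (Dec a) (Seq (Inc b) (Inc c))).

Lemma runs_move2 a b c s : a <> b -> a <> c -> b <> c ->
  runs (move2 a b c) s (fun s' => s' a = 0 /\ s' b = s b + s a /\ s' c = s c + s a /\
    forall j, j <> a -> j <> b -> j <> c -> s' j = s j).
Proof.
  intros Hab Hac Hbc.
  remember (s a) as n eqn:E. revert s E.
  induction n as [|n IH]; intros s E.
  - apply runs_while0; auto. repeat split; auto; lia.
  - apply runs_whileS; [lia|].
    apply runs_seq. eapply runs_dec; [eauto|].
    apply runs_seq. apply runs_inc. apply runs_inc.
    eapply runs_weaken.
    { apply IH. rewrite !upd_other by auto. now rewrite upd_same. }
    cbv beta. intros s' (H1 & H2 & H3 & H4). repeat split; auto.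
    + rewrite H2. rewrite upd_other, upd_same, upd_other by auto. lia.
    + rewrite H3. rewrite upd_same, upd_other, upd_other by auto. lia.
    + intros j ? ? ?. rewrite H4 by auto. rewrite !upd_other by auto. auto.
Qed.

Definition copy (src dst tmp : nat) : cmd :=
  Seq (clear dst) (Seq (clear tmp)
    (Seq (move2 src dst tmp) (While tmp (Seq (Dec tmp) (Inc src))))).

Lemma runs_move a b s : a <> b ->
  runs (While a (Seq (Dec a) (Inc b))) s (fun s' => s' a = 0 /\ s' b = s b + s a /\
    forall j, j <> a -> j <> b -> s' j = s j).
Proof.
  intros Hab.
  remember (s a) as n eqn:E. revert s E.
  induction n as [|n IH]; intros s E.
  - apply runs_while0; auto. repeat split; auto; lia.
  - apply runs_whileS; [lia|].
    apply runs_seq. eapply runs_dec; [eauto|]. apply runs_inc.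
    eapply runs_weaken.
    { apply IH. rewrite upd_other by auto. now rewrite upd_same. }
    cbv beta. intros s' (H1 & H2 & H4). repeat split; auto.
    + rewrite H2. rewrite upd_same, upd_other by auto. lia.
    + intros j ? ?. rewrite H4 by auto. rewrite !upd_other by auto. auto.
Qed.

Lemma runs_copy src dst tmp s : src <> dst -> src <> tmp -> dst <> tmp ->
  runs (copy src dst tmp) s (fun s' => s' dst = s src /\
    forall j, j <> dst -> j <> tmp -> s' j = s j).
Proof.
  intros H1 H2 H3. unfold copy.
  apply runs_seq. eapply runs_weaken; [apply runs_clear|]. cbv beta.
  intros s1 [A1 B1].
  apply runs_seq. eapply runs_weaken; [apply runs_clear|]. cbv beta.
  intros s2 [A2 B2].
  apply runs_seq. eapply runs_weaken; [apply runs_move2; auto|]. cbv beta.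
  intros s3 (A3 & B3 & C3 & D3).
  eapply runs_weaken; [apply runs_move; auto|]. cbv beta.
  intros s4 (A4 & B4 & C4).
  split.
  - rewrite C4, B3, (B2 dst), A1, (B2 src), (B1 src) by auto. lia.
  - intros j Hj1 Hj2. destruct (Nat.eq_dec j src) as [->|Hj].
    + rewrite B4, A3, C3, A2, (B2 src), (B1 src) by auto. lia.
    + rewrite C4, D3, B2, B1 by auto. auto.
Qed.

Fixpoint prf_nested_ind (P : prf -> Prop)
  (HZ : P PZero) (HS : P PSucc) (HP : forall i, P (PProj i))
  (HC : forall f gs, P f -> Forall P gs -> P (PComp f gs))
  (HR : forall f g, P f -> P g -> P (PRec f g))
  (HM : forall f, P f -> P (PMu f)) (c : prf) : P c :=
  let rec := prf_nested_ind P HZ HS HP HC HR HM in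
  match c with
  | PZero => HZ
  | PSucc => HS
  | PProj i => HP i
  | PComp f gs => HC f gs (rec f)
      ((fix all l : Forall P l :=
          match l with
          | [] => Forall_nil P
          | g :: l' => Forall_cons g (rec g) (all l')
          end) gs)
  | PRec f g => HR f g (rec f) (rec g)
  | PMu f => HM f (rec f)
  end.

(* Registers [>= fr] are scratch; [out] may not be an argument. *)
Fixpoint compile_prf (f : prf) (args : list nat) (out fr : nat) : cmd :=
  match f with
  | PZero => clear out
  | PSucc => Seq (copy (hd 0 args) out fr) (Inc out)
  | PProj i => copy (nth i args 0) out fr
  | PComp f gs =>
      let k := length gs in
      Seq ((fix compile_prfs l j := match l with
            | [] => Skip
            | g :: l' => Seq (compile_prf g args j (fr + k)) (compile_prfs l' (S j))
            end) gs fr)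
          (compile_prf f (seq fr k) out (fr + k))
  | PRec f g =>
      let rest := tl args in
      Seq (copy (hd 0 args) fr (fr + 3))
      (Seq (clear (fr + 1))
      (Seq (compile_prf f rest (fr + 2) (fr + 4))
      (Seq (While fr
             (Seq (compile_prf g (fr + 1 :: fr + 2 :: rest) (fr + 3) (fr + 4))
             (Seq (copy (fr + 3) (fr + 2) (fr + 4))
             (Seq (Inc (fr + 1)) (Dec fr)))))
           (copy (fr + 2) out (fr + 3)))))
  | PMu f =>
      Seq (clear fr)
      (Seq (compile_prf f (fr :: args) (fr + 1) (fr + 2))
      (Seq (While (fr + 1)
             (Seq (Inc fr) (compile_prf f (fr :: args) (fr + 1) (fr + 2))))
           (copy fr out (fr + 1))))
  end.

(** Standalone form of the local fixpoint inside [compile_prf], so that inductions over the list of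
    argument functions can be stated. *)
Fixpoint compile_prfs (l : list prf) (args : list nat) (j fr : nat) : cmd :=
  match l with
  | [] => Skip
  | g :: l' => Seq (compile_prf g args j fr) (compile_prfs l' args (S j) fr)
  end.

Lemma compile_prf_PComp f gs args out fr :
  compile_prf (PComp f gs) args out fr =
  Seq (compile_prfs gs args fr (fr + length gs))
      (compile_prf f (seq fr (length gs)) out (fr + length gs)).
Proof.
  simpl. f_equal. generalize (fr + length gs) as k. generalize fr as j.
  induction gs as [|g gs IH]; intros j k; simpl; auto. now rewrite IH.
Qed.

(** Nothing is assumed about the registers from [fr] on, so a block can be rerun inside a loop on
    dirty scratch space. The frame condition protects the arguments and the counters of enclosing
    loops. *)
Definition compile_prf_ok (f : prf) : Prop :=
  forall xs y, peval f xs y ->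
  forall args out fr s, map s args = xs -> Forall (fun a => a < fr) args ->
    out < fr -> ~ In out args ->
    runs (compile_prf f args out fr) s (fun s' => s' out = y /\
      forall j, j < fr -> j <> out -> s' j = s j).

(** [peval] unfolds the recursion from the top, whereas the compiled loop counts up from 0; the
    function [t] of intermediate values lets the loop invariant name the value at any index. *)
Lemma prec_trace f g n xs y : peval (PRec f g) (n :: xs) y ->
  exists t : nat -> nat, t n = y /\ peval f xs (t 0) /\
    forall m, m < n -> peval g (m :: t m :: xs) (t (S m)).
Proof.
  revert y. induction n as [|n IH]; intros y H; inversion H; subst.
  - exists (fun _ => y). repeat split; auto. intros; lia.
  - match goal with H1 : peval (PRec f g) _ _ |- _ =>
      destruct (IH _ H1) as (t & T1 & T2 & T3) end.
    exists (fun m => if Nat.eqb m (S n) then y else t m).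
    split; [now rewrite Nat.eqb_refl|]. split; [exact T2|].
    intros m Hm. replace (Nat.eqb m (S n)) with false
      by (symmetry; apply Nat.eqb_neq; lia).
    change (Nat.eqb (S m) (S n)) with (Nat.eqb m n).
    destruct (Nat.eqb_spec m n) as [->|Hn].
    + now rewrite T1.
    + apply T3. lia.
Qed.

Lemma map_ext_lt (s s' : store) args b : Forall (fun a => a < b) args ->
  (forall j, j < b -> s' j = s j) -> map s' args = map s args.
Proof.
  intros H E. apply map_ext_in. intros a Ha. apply E.
  rewrite Forall_forall in H. auto.
Qed.

Lemma Forall_lt_weaken args a b :
  Forall (fun x => x < a) args -> a <= b -> Forall (fun x => x < b) args.
Proof. intros H Hab. eapply Forall_impl; [|exact H]. simpl. lia. Qed.

Lemma not_in_of_Forall_lt args a b : Forall (fun x => x < a) args -> a <= b -> ~ In b args.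
Proof. intros H Hab Hin. rewrite Forall_forall in H. apply H in Hin. lia. Qed.

Lemma compile_prf_ok_comps gs : Forall compile_prf_ok gs ->
  forall xs ys, Forall2 (fun g y => peval g xs y) gs ys ->
  forall args j fr a s, map s args = xs -> Forall (fun x => x < a) args ->
    a <= j -> j + length gs <= fr ->
    runs (compile_prfs gs args j fr) s (fun s' => map s' (seq j (length gs)) = ys /\
      forall i, i < j -> s' i = s i).
Proof.
  induction 1 as [|g gs Hg Hgs IH]; intros xs ys H2 args j fr a s Hs Ha Haj Hfr;
    inversion H2; subst; simpl.
  - apply runs_skip. auto.
  - apply runs_seq. simpl in Hfr. eapply runs_weaken.
    { eapply Hg; eauto.
      - eapply Forall_lt_weaken; eauto; lia.
      - lia.
      - eapply not_in_of_Forall_lt; eauto. }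
    cbv beta. intros s1 [A1 B1]. eapply runs_weaken.
    { eapply IH with (a := a); eauto; try lia.
      eapply map_ext_lt; eauto. intros i Hi. apply B1; lia. }
    cbv beta. intros s2 [A2 B2]. split.
    + rewrite A2. f_equal. rewrite B2 by lia. auto.
    + intros i Hi. rewrite B2, B1 by lia. auto.
Qed.

Lemma compile_prf_ok_rec f g : compile_prf_ok f -> compile_prf_ok g -> compile_prf_ok (PRec f g).
Proof.
  intros Hf Hg xs y H args out fr s Hs Hargs Hout Hnin.
  destruct args as [|a0 rest].
  { simpl in Hs; subst; inversion H. }
  simpl in Hs. subst xs.
  apply prec_trace in H. destruct H as (t & T1 & T2 & T3).
  inversion Hargs as [|? ? Ha0 Hrest]; subst.
  simpl in Hnin. simpl.
  apply runs_seq. eapply runs_weaken; [apply runs_copy; lia|]. cbv beta.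
  intros s1 [A1 B1].
  apply runs_seq. eapply runs_weaken; [apply runs_clear|]. cbv beta.
  intros s2 [A2 B2].
  assert (E2 : forall j, j < fr -> s2 j = s j).
  { intros j Hj. rewrite B2, B1 by lia. auto. }
  apply runs_seq. eapply runs_weaken.
  { eapply Hf; [exact T2| | | |].
    - eapply map_ext_lt; eauto.
    - eapply Forall_lt_weaken; eauto; lia.
    - lia.
    - eapply not_in_of_Forall_lt; eauto; lia. }
  cbv beta. intros s3 [A3 B3].
  (* Loop invariant: [fr] holds the number of iterations left, [fr + 1] the index, [fr + 2] the
     current value. The next value goes through [fr + 3] because an output register may not be an
     argument. *)
  assert (L : forall k m s', k + m = s a0 -> s' fr = k -> s' (fr + 1) = m ->
    s' (fr + 2) = t m -> (forall j, j < fr -> s' j = s j) ->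
    runs (While fr
             (Seq (compile_prf g (fr + 1 :: fr + 2 :: rest) (fr + 3) (fr + 4))
             (Seq (copy (fr + 3) (fr + 2) (fr + 4))
             (Seq (Inc (fr + 1)) (Dec fr))))) s'
      (fun s'' => s'' (fr + 2) = t (s a0) /\ forall j, j < fr -> s'' j = s j)).
  { induction k as [|k IH]; intros m s' Hkm K1 K2 K3 K4.
    - apply runs_while0; auto. split; auto. rewrite K3. f_equal. lia.
    - apply runs_whileS; [lia|].
      apply runs_seq. eapply runs_weaken.
      { eapply Hg with (s := s'); [apply (T3 m); lia| | | |].
        - simpl. rewrite K2, K3. do 2 f_equal. eapply map_ext_lt; eauto.
        - repeat constructor; try lia. eapply Forall_lt_weaken; eauto; lia.
        - lia.
        - simpl. intros [?|[?|?]]; try lia.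
          eapply (not_in_of_Forall_lt rest fr (fr + 3)); eauto; lia. }
      cbv beta. intros s4 [A4 B4].
      apply runs_seq. eapply runs_weaken; [apply runs_copy; lia|]. cbv beta.
      intros s5 [A5 B5].
      apply runs_seq. apply runs_inc.
      eapply runs_dec with (n := k).
      { rewrite upd_other, B5, B4 by lia. auto. }
      apply (IH (S m)); try lia.
      + now rewrite upd_same.
      + rewrite upd_other, upd_same, B5, B4 by lia. auto.
      + rewrite !upd_other, A5, A4 by lia. auto.
      + intros j Hj. rewrite !upd_other, B5, B4 by lia. auto. }
  apply runs_seq. eapply runs_weaken.
  { apply (L (s a0) 0); auto; try lia.
    - rewrite B3, B2, A1 by lia. auto.
    - rewrite B3, A2 by lia. auto.
    - intros j Hj. rewrite B3, E2 by lia. auto. }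
  cbv beta. intros s4 [A4 B4].
  eapply runs_weaken; [apply runs_copy; lia|]. cbv beta.
  intros s5 [A5 B5]. split.
  - now rewrite A5, A4.
  - intros j Hj Hne. rewrite B5, B4 by lia. auto.
Qed.

Lemma compile_prf_ok_mu f : compile_prf_ok f -> compile_prf_ok (PMu f).
Proof.
  intros Hf xs y H args out fr s Hs Hargs Hout Hnin.
  inversion H as [| | | | | |? ? ? H0 Hlt]; subst.
  simpl.
  apply runs_seq. eapply runs_weaken; [apply runs_clear|]. cbv beta.
  intros s1 [A1 B1].
  assert (Step : forall m s', m <= y -> s' fr = m ->
    (forall j, j < fr -> s' j = s j) ->
    runs (compile_prf f (fr :: args) (fr + 1) (fr + 2)) s'
      (fun s'' => s'' fr = m /\ (s'' (fr + 1) = 0 <-> m = y) /\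
        forall j, j < fr -> s'' j = s j)).
  { intros m s' Hm K1 K2.
    assert (exists v, peval f (m :: map s args) v /\ (v = 0 <-> m = y)) as (v & Hv & Ev).
    { destruct (Nat.eq_dec m y) as [->|Hne].
      - exists 0. tauto.
      - destruct (Hlt m) as [k Hk]; [lia|]. exists (S k). split; auto. split; lia. }
    eapply runs_weaken.
    { eapply Hf with (s := s'); [exact Hv| | | |].
      - simpl. rewrite K1. f_equal. eapply map_ext_lt; eauto.
      - constructor; [lia|]. eapply Forall_lt_weaken; eauto; lia.
      - lia.
      - simpl. intros [?|?]; try lia.
        eapply (not_in_of_Forall_lt args fr (fr + 1)); eauto; lia. }
    cbv beta. intros s4 [A4 B4]. split; [|split].
    - rewrite B4 by lia. auto.
    - now rewrite A4.
    - intros j Hj. rewrite B4 by lia. auto. }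
  assert (L : forall k m s', k + m = y -> s' fr = m -> (s' (fr + 1) = 0 <-> m = y) ->
    (forall j, j < fr -> s' j = s j) ->
    runs (While (fr + 1) (Seq (Inc fr) (compile_prf f (fr :: args) (fr + 1) (fr + 2)))) s'
      (fun s'' => s'' fr = y /\ forall j, j < fr -> s'' j = s j)).
  { induction k as [|k IH]; intros m s' Hkm K1 K2 K3.
    - apply runs_while0; [apply K2; lia|]. split; auto; lia.
    - apply runs_whileS; [rewrite K2; lia|].
      apply runs_seq. apply runs_inc. eapply runs_weaken.
      { apply (Step (S m)); try lia.
        - rewrite upd_same. lia.
        - intros j Hj. rewrite upd_other by lia. auto. }
      cbv beta. intros s2 (A2 & B2 & C2). apply (IH (S m)); auto; lia. }
  apply runs_seq. eapply runs_weaken.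
  { apply (Step 0); auto; try lia. intros j Hj. apply B1; lia. }
  cbv beta. intros s2 (A2 & B2 & C2).
  apply runs_seq. eapply runs_weaken.
  { apply (L y 0); auto; lia. }
  cbv beta. intros s3 [A3 B3].
  eapply runs_weaken; [apply runs_copy; lia|]. cbv beta.
  intros s4 [A4 B4]. split.
  - now rewrite A4.
  - intros j Hj Hne. rewrite B4, B3 by lia. auto.
Qed.

Lemma compile_prf_correct f : compile_prf_ok f.
Proof.
  induction f as [| |i|f gs IHf IHgs|f g IHf IHg|f IHf] using prf_nested_ind.
  - intros xs y H args out fr s Hs Hargs Hout Hnin. inversion H; subst. simpl.
    eapply runs_weaken; [apply runs_clear|]. cbv beta. intros s' [A B]. auto.
  - intros xs y H args out fr s Hs Hargs Hout Hnin.
    destruct args as [|a args]; subst xs; inversion H; subst. simpl.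
    inversion Hargs; subst. simpl in Hnin.
    apply runs_seq. eapply runs_weaken; [apply runs_copy; lia|]. cbv beta.
    intros s' [A B]. apply runs_inc. split.
    + rewrite upd_same. congruence.
    + intros j Hj Hne. rewrite upd_other, B by lia. auto.
  - intros xs y H args out fr s Hs Hargs Hout Hnin. inversion H; subst. simpl.
    rewrite length_map in *.
    assert (Hin : In (nth i args 0) args) by (apply nth_In; auto).
    assert (nth i args 0 <> out) by congruence.
    rewrite Forall_forall in Hargs. specialize (Hargs _ Hin). simpl in Hargs.
    eapply runs_weaken; [apply runs_copy; lia|]. cbv beta. intros s' [A B].
    split.
    + rewrite A. rewrite (nth_indep (map s args) 0 (s 0)) by now rewrite length_map.
      symmetry. apply map_nth.
    + intros j Hj Hne. apply B; lia.
  - intros xs y H args out fr s Hs Hargs Hout Hnin. rewrite compile_prf_PComp.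
    inversion H; subst.
    apply runs_seq. eapply runs_weaken.
    { eapply compile_prf_ok_comps with (a := fr); eauto. }
    cbv beta. intros s1 [A1 B1]. eapply runs_weaken.
    { eapply IHf; [eassumption| | | |].
      - exact A1.
      - apply Forall_forall. intros x Hx. apply in_seq in Hx. lia.
      - lia.
      - intros Hx. apply in_seq in Hx. lia. }
    cbv beta. intros s2 [A2 B2]. split; auto.
    intros j Hj Hne. rewrite B2, B1 by lia. auto.
  - now apply compile_prf_ok_rec.
  - now apply compile_prf_ok_mu.
Qed.

(** * Flat code acting on a single number *)

Inductive instr : Type :=
| IInc : nat -> instr
| IDec : nat -> instr
| IJz : nat -> nat -> instr
| IJmp : nat -> instr.

Definition zprime (r : nat) : Z := Z.of_nat (reg_prime r).

Lemma zprime_ge2 r : (2 <= zprime r)%Z.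
Proof. unfold zprime. pose proof (reg_prime_ge2 r). lia. Qed.

(** Stated over [Z] because counters read off a word may become negative. A register is zero when
    its prime does not divide the memory: then [IJz] jumps and [IDec] is stuck. *)
Definition irel (i : instr) (k A Q B : Z) : Prop :=
  match i with
  | IInc r => (B = zprime r * A /\ Q = k + 1)%Z
  | IDec r => (zprime r * B = A /\ Q = k + 1)%Z
  | IJz r a => (B = A /\ ((A mod zprime r <> 0 /\ Q = Z.of_nat a) \/
                          (A mod zprime r = 0 /\ Q = k + 1)))%Z
  | IJmp a => (B = A /\ Q = Z.of_nat a)%Z
  end.

Definition zstep (code : list instr) (x y : Z * Z) : Prop :=
  exists k i, nth_error code k = Some i /\ fst x = Z.of_nat k /\
    irel i (Z.of_nat k) (snd x) (fst y) (snd y).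

Inductive zsteps (code : list instr) : Z * Z -> Z * Z -> Prop :=
| zsteps_refl x : zsteps code x x
| zsteps_step x y z : zstep code x y -> zsteps code y z -> zsteps code x z.

Lemma zsteps_trans code x y z : zsteps code x y -> zsteps code y z -> zsteps code x z.
Proof. induction 1; auto. intros. econstructor; eauto. Qed.

Lemma zsteps_one code x y : zstep code x y -> zsteps code x y.
Proof. intros. econstructor; eauto. constructor. Qed.

Lemma zstep_det code x y z : zstep code x y -> zstep code x z -> y = z.
Proof.
  destruct x as [P A], y as [Q B], z as [Q' B'].
  intros (k & i & H1 & H2 & H3) (k' & i' & H1' & H2' & H3'). simpl in *.
  assert (k = k') by lia. subst k'. rewrite H1 in H1'. injection H1' as <-.
  destruct i as [r|r|r a|a]; simpl in *; try (f_equal; lia).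
  pose proof (zprime_ge2 r).
  destruct H3 as [H3 ->], H3' as [H3' ->]. f_equal. nia.
Qed.

Lemma zstep_halt code A y : ~ zstep code (Z.of_nat (length code), A) y.
Proof.
  intros (k & i & H1 & H2 & _). simpl in H2. apply Nat2Z.inj in H2. subst k.
  assert (nth_error code (length code) <> None) by congruence.
  apply nth_error_Some in H. lia.
Qed.

Lemma zsteps_halt_unique code x A A' :
  zsteps code x (Z.of_nat (length code), A) ->
  zsteps code x (Z.of_nat (length code), A') -> A = A'.
Proof.
  intros H. remember (Z.of_nat (length code), A) as y eqn:E. revert E.
  induction H as [x|x y z Hs H IH]; intros E H'.
  - subst. inversion H' as [|? w ? Hw]; subst; auto. now apply zstep_halt in Hw.
  - inversion H' as [|? w ? Hw]; subst.
    + now apply zstep_halt in Hs.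
    + rewrite (zstep_det _ _ _ _ Hs Hw) in *. auto.
Qed.

Fixpoint clen (c : cmd) : nat :=
  match c with
  | Skip => 0
  | Inc _ | Dec _ => 1
  | Seq c1 c2 => clen c1 + clen c2
  | While _ c => clen c + 2
  end.

Fixpoint compile (base : nat) (c : cmd) : list instr :=
  match c with
  | Skip => []
  | Inc r => [IInc r]
  | Dec r => [IDec r]
  | Seq c1 c2 => compile base c1 ++ compile (base + clen c1) c2
  | While r c => IJz r (base + clen c + 2) :: compile (S base) c ++ [IJmp base]
  end.

Lemma length_compile c : forall base, length (compile base c) = clen c.
Proof.
  induction c; intros base; simpl; auto.
  - rewrite length_app. congruence.
  - rewrite length_app, IHc. simpl. lia.
Qed.

Definition code_at (code : list instr) (base : nat) (l : list instr) : Prop :=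
  forall j i, nth_error l j = Some i -> nth_error code (base + j) = Some i.

Lemma code_at_app code base l1 l2 : code_at code base (l1 ++ l2) ->
  code_at code base l1 /\ code_at code (base + length l1) l2.
Proof.
  intros H. split; intros j i Hj.
  - apply H. rewrite nth_error_app1; auto. apply nth_error_Some. congruence.
  - rewrite <- Nat.add_assoc. apply H.
    rewrite nth_error_app2 by lia. rewrite <- Hj. f_equal. lia.
Qed.

Lemma code_at_cons code base a l : code_at code base (a :: l) ->
  nth_error code base = Some a /\ code_at code (S base) l.
Proof.
  intros H. split.
  - rewrite <- (Nat.add_0_r base). now apply H.
  - intros j i Hj. replace (S base + j) with (base + S j) by lia. now apply H.
Qed.

Definition encodes (N : nat) (s : store) : Prop :=
  0 < N /\ forall r, reg_val r N = s r.

Definition at_pc (pc N : nat) : Z * Z := (Z.of_nat pc, Z.of_nat N).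

Lemma reg_prime_dvd r N : 0 < N ->
  (Z.of_nat N mod zprime r = 0)%Z <-> reg_val r N <> 0.
Proof.
  intros HN. unfold zprime. pose proof (reg_prime_ge2 r) as Hp. split.
  - intros H. rewrite <- Nat2Z.inj_mod in H.
    assert (H0 : N mod reg_prime r = 0) by lia.
    apply Nat.Div0.div_exact in H0. rewrite H0, reg_val_mul_same; [lia|].
    destruct (N / reg_prime r); lia.
  - intros H. destruct (reg_val_pos r N HN) as [M ->]; [lia|].
    rewrite Nat2Z.inj_mul, Z.mul_comm. apply Z_mod_mult.
Qed.

(** A forward simulation suffices; that no other halting memory exists is [zsteps_halt_unique]. *)
Lemma compile_correct code c s s' : exec c s s' ->
  forall base N, code_at code base (compile base c) -> encodes N s ->
  exists N', encodes N' s' /\ zsteps code (at_pc base N) (at_pc (base + clen c) N').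
Proof.
  induction 1 as [s|r s|r s n E|c1 c2 s s1 s2 H1 IH1 H2 IH2|r c s E|r c s s1 s2 E H1 IH1 H2 IH2];
    intros base N Hc HN; simpl in Hc; simpl clen.
  - exists N. split; auto. rewrite Nat.add_0_r. constructor.
  - apply code_at_cons in Hc. destruct HN as [HN Hv].
    pose proof (reg_prime_ge2 r).
    exists (reg_prime r * N). split.
    + split; [nia|]. intros r'. destruct (Nat.eq_dec r' r) as [->|Hr].
      * rewrite upd_same, reg_val_mul_same by auto. now rewrite Hv.
      * rewrite upd_other, reg_val_mul_other by auto. auto.
    + apply zsteps_one. exists base, (IInc r). simpl. unfold zprime. intuition lia.
  - apply code_at_cons in Hc. destruct HN as [HN Hv].
    pose proof (reg_prime_ge2 r).
    destruct (reg_val_pos r N) as [M ->]; auto.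
    { rewrite Hv. lia. }
    assert (0 < M) by nia.
    exists M. split.
    + split; auto. intros r'. specialize (Hv r').
      destruct (Nat.eq_dec r' r) as [->|Hr].
      * rewrite reg_val_mul_same in Hv by auto. rewrite upd_same. lia.
      * rewrite reg_val_mul_other in Hv by auto. rewrite upd_other by auto. auto.
    + apply zsteps_one. exists base, (IDec r). simpl. unfold zprime. intuition lia.
  - apply code_at_app in Hc. rewrite length_compile in Hc. destruct Hc as [Hc1 Hc2].
    destruct (IH1 _ _ Hc1 HN) as (N1 & HN1 & S1).
    destruct (IH2 _ _ Hc2 HN1) as (N2 & HN2 & S2).
    exists N2. split; auto. rewrite Nat.add_assoc. eapply zsteps_trans; eauto.
  - apply code_at_cons in Hc. destruct Hc as [Hc _].
    exists N. split; auto. apply zsteps_one. exists base, (IJz r (base + clen c + 2)).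
    destruct HN as [HN Hv]. simpl. repeat split; auto.
    left. rewrite reg_prime_dvd by auto. rewrite Hv. split; [tauto|lia].
  - pose proof Hc as Hc0. apply code_at_cons in Hc. destruct Hc as [Hj Hc].
    apply code_at_app in Hc. rewrite length_compile in Hc. destruct Hc as [Hc Hm].
    apply code_at_cons in Hm. destruct Hm as [Hm _].
    destruct (IH1 _ _ Hc HN) as (N1 & HN1 & S1).
    destruct (IH2 base N1) as (N2 & HN2 & S2); auto.
    exists N2. split; auto. simpl in S2.
    eapply zsteps_step with (y := at_pc (S base) N).
    { exists base, (IJz r (base + clen c + 2)).
      destruct HN as [HN Hv]. simpl. repeat split; auto.
      right. rewrite reg_prime_dvd by auto. rewrite Hv. split; [auto|lia]. }
    eapply zsteps_trans; [exact S1|].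
    eapply zsteps_step; [|exact S2].
    exists (S base + clen c), (IJmp base). simpl. auto.
Qed.

(** A single measure bounding the code length, the jump addresses and the primes, from which the
    dimension and the weights of the transformer are bounded. *)
Fixpoint csize (c : cmd) : nat :=
  match c with
  | Skip => 0
  | Inc r | Dec r => S (reg_prime r)
  | Seq c1 c2 => csize c1 + csize c2
  | While r c => csize c + reg_prime r + 2
  end.

Lemma clen_le_csize c : clen c <= csize c.
Proof. induction c; simpl; lia. Qed.

Definition instr_bound (K : nat) (i : instr) : Prop :=
  match i with
  | IInc r | IDec r => reg_prime r <= K
  | IJz r a => reg_prime r <= K /\ a <= K
  | IJmp a => a <= K
  end.

Lemma instr_bound_weaken K K' i : instr_bound K i -> K <= K' -> instr_bound K' i.
Proof. destruct i; simpl; lia. Qed.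

Lemma compile_bound c : forall base,
  Forall (instr_bound (base + csize c)) (compile base c).
Proof.
  assert (W : forall K K' l, Forall (instr_bound K) l -> K <= K' ->
    Forall (instr_bound K') l).
  { intros K K' l H HK. eapply Forall_impl; [|exact H].
    intros i Hi. eapply instr_bound_weaken; eauto. }
  induction c as [|r|r|c1 IH1 c2 IH2|r c IH]; intros base; simpl.
  - constructor.
  - repeat constructor; simpl; lia.
  - repeat constructor; simpl; lia.
  - pose proof (clen_le_csize c1). apply Forall_app. split.
    + eapply W; [apply IH1|lia].
    + eapply W; [apply IH2|lia].
  - pose proof (clen_le_csize c). constructor; [simpl; lia|].
    apply Forall_app. split.
    + eapply W; [apply IH|lia].
    + repeat constructor. simpl. lia.
Qed.

Fixpoint set_input (n : nat) (c : cmd) : cmd :=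
  match n with
  | 0 => c
  | S m => Seq (Inc 0) (set_input m c)
  end.

Lemma csize_set_input n c : csize (set_input n c) = n * S (reg_prime 0) + csize c.
Proof. induction n as [|n IH]; cbn [set_input csize]; [|rewrite IH]; lia. Qed.

Lemma runs_set_input c n : forall s Q,
  (forall s', s' 0 = s 0 + n -> (forall j, j <> 0 -> s' j = s j) -> runs c s' Q) ->
  runs (set_input n c) s Q.
Proof.
  induction n as [|n IH]; intros s Q H; simpl set_input.
  - apply H; auto; lia.
  - apply runs_seq. apply runs_inc. apply IH. intros s' H0 H1. apply H.
    + rewrite H0, upd_same. lia.
    + intros j Hj. rewrite H1, upd_other; auto.
Qed.

(** Hardwiring the input by [n] increments lets every run start from memory 1, the code of the
    all-zero store, at a cost linear in [n]. *)
Definition program (f : prf) (n : nat) : cmd := set_input n (compile_prf f [0] 1 2).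

Lemma program_halts f n y : peval f [n] y ->
  exists N : nat, y < N /\
    zsteps (compile 0 (program f n)) (0, 1)%Z
      (Z.of_nat (length (compile 0 (program f n))), Z.of_nat N).
Proof.
  intros H.
  assert (R : runs (program f n) (fun _ => 0) (fun s' => s' 1 = y)).
  { apply runs_set_input. intros s' H0 _.
    eapply runs_weaken.
    - eapply compile_prf_correct; eauto.
      + simpl. now rewrite H0.
      + simpl. lia.
    - cbv beta. tauto. }
  destruct R as (s' & He & Hy).
  destruct (compile_correct (compile 0 (program f n)) _ _ _ He 0 1) as (N & [HN Hv] & HS).
  - intros j i Hj. exact Hj.
  - split; [lia|]. intros r. apply reg_val_one.
  - exists N. split.
    + rewrite <- Hy, <- Hv. now apply reg_val_lt.
    + rewrite length_compile. exact HS.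
Qed.

(** * Size of transformers and computable bounds *)

Lemma sumN_map_le (A : Type) (f : A -> nat) l b :
  (forall x, In x l -> f x <= b) -> sumN (map f l) <= length l * b.
Proof.
  induction l as [|x l IH]; intros H; cbn; [lia|].
  specialize (H x (or_introl eq_refl)) as Hx.
  assert (sumN (map f l) <= length l * b) by (apply IH; intros y Hy; apply H; now right).
  unfold sumN in *. lia.
Qed.

Lemma bitsZ_le p m : 1 <= p -> in_F p m -> bitsZ m <= p + 1.
Proof.
  intros Hp [H1 H2]. unfold bitsZ, fp_lo, fp_hi in *.
  assert (L : (Z.log2 (Z.abs m) <= Z.of_nat p - 1)%Z).
  { rewrite <- (Z.log2_pow2 (Z.of_nat p - 1)) by lia. apply Z.log2_le_mono. lia. }
  lia.
Qed.

Lemma bitsV_le p d v : 1 <= p -> in_Fvec p d v -> bitsV v <= d * (p + 1).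
Proof.
  intros Hp [<- Hv]. apply sumN_map_le. intros x Hx.
  rewrite Forall_forall in Hv. apply bitsZ_le; auto.
Qed.

Lemma F_elems_in_F p x : 1 <= p -> In x (F_elems p) -> in_F p x.
Proof.
  intros Hp H. apply in_map_iff in H. destruct H as (k & <- & Hk). apply in_seq in Hk.
  assert (E : 2 ^ p = 2 * 2 ^ (p - 1)) by (rewrite <- Nat.pow_succ_r'; f_equal; lia).
  assert (E' : (2 ^ (Z.of_nat p - 1) = Z.of_nat (2 ^ (p - 1)))%Z).
  { rewrite Nat2Z.inj_pow. f_equal. lia. }
  unfold in_F, fp_lo, fp_hi. lia.
Qed.

Lemma F_vecs_spec p d : 1 <= p ->
  length (F_vecs p d) = (2 ^ p) ^ d /\ forall v, In v (F_vecs p d) -> in_Fvec p d v.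
Proof.
  intros Hp. induction d as [|d [IH1 IH2]].
  - split; [reflexivity|]. intros v [<-|[]]. split; [reflexivity|constructor].
  - split.
    + cbn [F_vecs]. rewrite flat_map_concat_map, length_concat, map_map.
      rewrite (map_ext _ (fun _ => 2 ^ p)).
      2:{ intros v. rewrite length_map. unfold F_elems. now rewrite length_map, length_seq. }
      rewrite Nat.pow_succ_r', <- IH1. clear.
      induction (F_vecs p d) as [|v l IH]; cbn [map list_sum fold_right length]; [lia|].
      unfold list_sum in IH. lia.
    + intros v Hv. cbn [F_vecs] in Hv. apply in_flat_map in Hv.
      destruct Hv as (u & Hu & Hv). apply in_map_iff in Hv. destruct Hv as (x & <- & Hx).
      apply IH2 in Hu. destruct Hu as [Hu1 Hu2]. split; [cbn; congruence|].
      constructor; auto. now apply F_elems_in_F.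
Qed.

Lemma table_size_le p d f : 1 <= p ->
  (forall x, in_Fvec p d x -> in_Fvec p d (f x)) ->
  table_size p d f <= (2 ^ p) ^ d * (d * (p + 1)).
Proof.
  intros Hp H. destruct (F_vecs_spec p d Hp) as [E Hin]. rewrite <- E.
  apply sumN_map_le. intros x Hx. apply bitsV_le; auto.
Qed.

(** A function table has [2 ^ (p * d)] rows. The exponential is harmless, since only computability
    matters; the form uses just sums, products and powers of two for that reason. *)
Definition size_bound (nsym k p s d : nat) : nat :=
  p + s + d + k + nsym * (d * (p + 1))
  + k * (4 * (2 ^ (p * d) * (d * (p + 1)))) + 2 ^ (p * d) * (p + 1).

Lemma tsize_le nsym T : wf_transformer nsym T ->
  tsize nsym T <= size_bound nsym (depth T) (tp T) (Z.abs_nat (ts T)) (td T).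
Proof.
  intros (Hp & He & HL & Ho). unfold tsize, size_bound.
  rewrite Nat.pow_mul_r.
  set (p := tp T) in *. set (d := td T) in *.
  assert (A : sumN (map (fun a => bitsV (temb T a)) (seq 0 nsym)) <= nsym * (d * (p + 1))).
  { rewrite <- (length_seq nsym 0) at 2. apply sumN_map_le. intros a Ha.
    apply in_seq in Ha. apply bitsV_le; auto. apply He. lia. }
  assert (B : sumN (map (fun L => table_size p d (WQ L) + table_size p d (WK L)
      + table_size p d (WV L) + table_size p d (FF L)) (tlayers T))
      <= depth T * (4 * ((2 ^ p) ^ d * (d * (p + 1))))).
  { apply sumN_map_le. intros L HinL. specialize (HL L HinL).
    pose proof (table_size_le p d (WQ L) Hp) as H1.
    pose proof (table_size_le p d (WK L) Hp) as H2.
    pose proof (table_size_le p d (WV L) Hp) as H3.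
    pose proof (table_size_le p d (FF L) Hp) as H4.
    assert (table_size p d (WQ L) <= (2 ^ p) ^ d * (d * (p + 1))) by (apply H1; apply HL).
    assert (table_size p d (WK L) <= (2 ^ p) ^ d * (d * (p + 1))) by (apply H2; apply HL).
    assert (table_size p d (WV L) <= (2 ^ p) ^ d * (d * (p + 1))) by (apply H3; apply HL).
    assert (table_size p d (FF L) <= (2 ^ p) ^ d * (d * (p + 1))) by (apply H4; apply HL).
    lia. }
  assert (C : sumN (map (fun x => bitsZ (tout T x)) (F_vecs p d)) <= (2 ^ p) ^ d * (p + 1)).
  { destruct (F_vecs_spec p d Hp) as [E Hin]. rewrite <- E.
    apply sumN_map_le. intros x Hx. apply bitsZ_le; auto. }
  lia.
Qed.

Lemma size_bound_mono nsym k p p' s d d' : p <= p' -> d <= d' ->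
  size_bound nsym k p s d <= size_bound nsym k p' s d'.
Proof.
  intros Hp Hd. unfold size_bound.
  assert (A : d * (p + 1) <= d' * (p' + 1)) by (apply Nat.mul_le_mono; lia).
  assert (B : 2 ^ (p * d) <= 2 ^ (p' * d')).
  { apply Nat.pow_le_mono_r; [lia|]. now apply Nat.mul_le_mono. }
  assert (C : 2 ^ (p * d) * (d * (p + 1)) <= 2 ^ (p' * d') * (d' * (p' + 1)))
    by now apply Nat.mul_le_mono.
  assert (D : 2 ^ (p * d) * (p + 1) <= 2 ^ (p' * d') * (p' + 1))
    by (apply Nat.mul_le_mono; lia).
  assert (E : nsym * (d * (p + 1)) <= nsym * (d' * (p' + 1))) by now apply Nat.mul_le_mono_l.
  assert (F : k * (4 * (2 ^ (p * d) * (d * (p + 1))))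
     <= k * (4 * (2 ^ (p' * d') * (d' * (p' + 1))))) by (apply Nat.mul_le_mono_l; lia).
  lia.
Qed.

(** * Closure properties of computable functions *)

Lemma peval_comp1 f g xs y z : peval g xs y -> peval f [y] z -> peval (PComp f [g]) xs z.
Proof. intros. econstructor; eauto. Qed.

Lemma peval_comp2 f g1 g2 xs y1 y2 z : peval g1 xs y1 -> peval g2 xs y2 ->
  peval f [y1; y2] z -> peval (PComp f [g1; g2]) xs z.
Proof. intros. econstructor; eauto. Qed.

Lemma peval_proj i xs x : nth_error xs i = Some x -> peval (PProj i) xs x.
Proof.
  intros H. rewrite <- (nth_error_nth xs i 0 H). constructor.
  apply nth_error_Some. congruence.
Qed.

Definition prf_add : prf := PRec (PProj 0) (PComp PSucc [PProj 1]).

Lemma prf_add_correct n m : peval prf_add [n; m] (n + m).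
Proof.
  induction n as [|n IH].
  - constructor. now apply peval_proj.
  - econstructor; [exact IH|]. eapply peval_comp1; [now apply peval_proj|constructor].
Qed.

Definition prf_mul : prf := PRec PZero (PComp prf_add [PProj 2; PProj 1]).

Lemma prf_mul_correct n m : peval prf_mul [n; m] (n * m).
Proof.
  induction n as [|n IH].
  - constructor. constructor.
  - econstructor; [exact IH|].
    eapply peval_comp2; [now apply peval_proj|now apply peval_proj|apply prf_add_correct].
Qed.

Definition prf_pow2 : prf :=
  PRec (PComp PSucc [PZero]) (PComp prf_add [PProj 1; PProj 1]).

Lemma prf_pow2_correct n : peval prf_pow2 [n] (2 ^ n).
Proof.
  induction n as [|n IH].
  - constructor. eapply peval_comp1; constructor.
  - econstructor; [exact IH|]. cbn [Nat.pow]. rewrite Nat.mul_succ_l, Nat.mul_1_l.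
    eapply peval_comp2; [now apply peval_proj|now apply peval_proj|apply prf_add_correct].
Qed.

Lemma computable_id : computable (fun n => n).
Proof. exists (PProj 0). intros n. now apply peval_proj. Qed.

Lemma computable_const k : computable (fun _ => k).
Proof.
  induction k as [|k [c Hc]].
  - exists PZero. constructor.
  - exists (PComp PSucc [c]). intros n. eapply peval_comp1; [apply Hc|constructor].
Qed.

Lemma computable_add f g : computable f -> computable g -> computable (fun n => f n + g n).
Proof.
  intros [a Ha] [b Hb]. exists (PComp prf_add [a; b]). intros n.
  eapply peval_comp2; [apply Ha|apply Hb|apply prf_add_correct].
Qed.

Lemma computable_mul f g : computable f -> computable g -> computable (fun n => f n * g n).
Proof.
  intros [a Ha] [b Hb]. exists (PComp prf_mul [a; b]). intros n.
  eapply peval_comp2; [apply Ha|apply Hb|apply prf_mul_correct].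
Qed.

Lemma computable_pow2 f : computable f -> computable (fun n => 2 ^ f n).
Proof.
  intros [a Ha]. exists (PComp prf_pow2 [a]). intros n.
  eapply peval_comp1; [apply Ha|apply prf_pow2_correct].
Qed.

Lemma computable_comp f g : computable f -> computable g -> computable (fun n => f (g n)).
Proof.
  intros [a Ha] [b Hb]. exists (PComp a [b]). intros n.
  eapply peval_comp1; [apply Hb|apply Ha].
Qed.

Lemma computable_size_bound nsym k s p d : computable p -> computable d ->
  computable (fun n => size_bound nsym k (p n) s (d n)).
Proof.
  intros Hp Hd. unfold size_bound.
  repeat first [ apply (computable_add (fun n => _) (fun n => _))
               | apply (computable_mul (fun n => _) (fun n => _))
               | apply (computable_pow2 (fun n => _))
               | exact Hp | exact Hd | apply computable_const ].
Qed.

(** * Two-layer transformers checking linear prefix conditions *)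

Local Open Scope Z_scope.

Lemma Int_part_unique (r : R) (z : Z) : (IZR z <= r < IZR z + 1)%R -> Int_part r = z.
Proof.
  intros [H1 H2]. destruct (base_Int_part r) as [H3 H4].
  assert (IZR (Int_part r) < IZR (z + 1))%R by (rewrite plus_IZR; lra).
  assert (IZR z < IZR (Int_part r + 1))%R by (rewrite plus_IZR; lra).
  apply lt_IZR in H. apply lt_IZR in H0. lia.
Qed.

Lemma Int_part_div (a b : Z) : 0 < b -> Int_part (IZR a / IZR b) = a / b.
Proof.
  intros Hb. apply Int_part_unique.
  assert (Hb' : (0 < IZR b)%R) by (apply (IZR_lt 0); auto).
  assert (E : a = b * (a / b) + a mod b) by (apply Z_div_mod_eq_full).
  pose proof (Z.mod_pos_bound a b Hb) as [M1 M2].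
  apply IZR_le in M1. apply IZR_lt in M2.
  assert (E' : (IZR a / IZR b = IZR (a / b) + IZR (a mod b) / IZR b)%R).
  { rewrite E at 1. rewrite plus_IZR, mult_IZR. field. lra. }
  rewrite E'. split.
  - assert (0 <= IZR (a mod b) / IZR b)%R
      by (apply Rmult_le_pos; [lra|left; now apply Rinv_0_lt_compat]).
    lra.
  - assert (IZR (a mod b) / IZR b < 1)%R by (apply Rmult_lt_reg_r with (IZR b); auto;
      unfold Rdiv; rewrite Rmult_assoc, Rinv_l; lra). lra.
Qed.

Lemma fp_bounds p : (1 <= p)%nat -> fp_lo p <= -1 /\ 0 <= fp_hi p.
Proof.
  intros Hp. unfold fp_lo, fp_hi.
  assert (0 < 2 ^ (Z.of_nat p - 1)) by (apply Z.pow_pos_nonneg; lia). lia.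
Qed.

Lemma clampZ_in_F p z : (1 <= p)%nat -> in_F p (clampZ p z).
Proof. intros Hp. pose proof (fp_bounds p Hp). unfold in_F, clampZ. lia. Qed.

Lemma clampZ_id p z : in_F p z -> clampZ p z = z.
Proof. unfold in_F, clampZ. lia. Qed.

(** Saturation loses magnitudes but not signs, as the range contains -1 and 0. With
    [Z_div_nonneg_iff], this is why fixed precision decides exact inequalities on prefixes of any
    length. *)
Lemma clampZ_nonneg p z : (1 <= p)%nat -> (0 <= clampZ p z <-> 0 <= z).
Proof. intros Hp. pose proof (fp_bounds p Hp). unfold clampZ. lia. Qed.

Lemma in_F_small p z : (2 <= p)%nat -> -1 <= z <= 1 -> in_F p z.
Proof.
  intros Hp Hz. unfold in_F, fp_lo, fp_hi.
  assert (2 ^ 1 <= 2 ^ (Z.of_nat p - 1)) by (apply Z.pow_le_mono_r; lia). lia.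
Qed.

Definition zeros (d : nat) : list Z := repeat 0 d.

Lemma in_Fvec_zeros p d : (2 <= p)%nat -> in_Fvec p d (zeros d).
Proof.
  intros Hp. split; [apply repeat_length|]. apply Forall_forall. intros x Hx.
  apply repeat_spec in Hx. subst. apply in_F_small; lia.
Qed.

Lemma in_Fvec_cons p d x v : in_F p x -> in_Fvec p d v -> in_Fvec p (S d) (x :: v).
Proof. intros H [H1 H2]. split; [simpl; congruence|now constructor]. Qed.

Lemma nth_zeros d a : nth a (zeros d) 0 = 0.
Proof. apply nth_repeat. Qed.

Lemma sumZ_const_zero (A : Type) (f : A -> Z) l :
  (forall x, In x l -> f x = 0) -> sumZ (map f l) = 0.
Proof.
  induction l as [|x l IH]; intros H; cbn; auto.
  rewrite H by now left. apply IH. intros y Hy. apply H. now right.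
Qed.

Lemma powerRZ_2_0 : powerRZ 2 0 = 1%R. Proof. reflexivity. Qed.

Lemma dotR_zeros d v : dotR 0 (zeros d) v = 0%R.
Proof.
  unfold dotR, zeros. revert v.
  induction d as [|d IH]; intros [|x v]; cbn; auto.
  unfold sumR in IH. rewrite IH. unfold fval. lra.
Qed.

Definition uniform_layer (d : nat) (V F : list Z -> list Z) : layer :=
  {| WQ := fun _ => zeros d; WK := fun _ => zeros d; WV := V; FF := F |}.

Lemma fround_weight_one p d v : (2 <= p)%nat ->
  fround p 0 (exp (dotR 0 (zeros d) v)) = 1.
Proof.
  intros Hp. unfold fround. rewrite dotR_zeros, exp_0, powerRZ_2_0.
  replace (1 * 1)%R with (IZR 1 / IZR 1)%R by lra.
  rewrite Int_part_div by lia. apply clampZ_id, in_F_small; auto; cbn; lia.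
Qed.

(* With constantly zero queries and keys every weight is [round (exp 0) = 1],
   so each head computes the floor of the average of the values. *)
Lemma uniform_layer_apply p d V F hs : (2 <= p)%nat ->
  layer_apply p 0 d (uniform_layer d V F) hs =
  map (fun i => F (map (fun a =>
         clampZ p (clampZ p (sumZ (map (fun h => nth a (V h) 0) (firstn (S i) hs))
                             / Z.of_nat (S i))
                   + nth a (nth i hs nil) 0)) (seq 0 d)))
      (seq 0 (length hs)).
Proof.
  intros Hp. unfold layer_apply. apply map_ext_in. intros i Hi.
  apply in_seq in Hi. cbn [WQ WK WV FF uniform_layer]. cbv zeta.
  set (pre := firstn (S i) hs).
  assert (Hpre : length pre = S i) by (unfold pre; rewrite firstn_length_le; lia).
  set (ws := map _ pre).
  assert (Hws : ws = map (fun _ => 1) pre).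
  { apply map_ext. intros h. now apply fround_weight_one. }
  rewrite Hws. clear ws Hws.
  assert (HB : sumZ (map (fun _ : list Z => 1) pre) = Z.of_nat (S i)).
  { rewrite <- Hpre. clear. induction pre; cbn [map sumZ fold_right length]; auto.
    unfold sumZ in IHpre. rewrite IHpre. lia. }
  rewrite HB.
  destruct (Z.eqb_spec (Z.of_nat (S i)) 0) as [E|_]; [lia|].
  f_equal. apply map_ext_in. intros a Ha. apply in_seq in Ha.
  f_equal. f_equal.
  rewrite (nth_indep _ 0 (fround p 0 (sumR (map (fun '(w, v) => IZR w * fval 0 (nth a v 0%Z))
     (combine (map (fun _ => 1%Z) pre) (map V pre))) / IZR (Z.of_nat (S i))))%R)
    by (rewrite length_map, length_seq; lia).
  match goal with |- nth a (map ?f (seq 0 d)) _ = _ => rewrite (map_nth f (seq 0 d) a a) end.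
  rewrite seq_nth by lia. cbn [Nat.add].
  assert (HS : sumR (map (fun '(w, v) => IZR w * fval 0 (nth a v 0%Z))
     (combine (map (fun _ => 1%Z) pre) (map V pre)))%R =
     IZR (sumZ (map (fun h => nth a (V h) 0) pre))).
  { clear. induction pre as [|h pre IH]; cbn [map combine sumR sumZ fold_right]; auto.
    unfold sumR, sumZ in IH. rewrite IH, plus_IZR. unfold fval.
    change (- 0)%Z with 0. rewrite powerRZ_2_0. lra. }
  rewrite HS. unfold fround. rewrite powerRZ_2_0, Rmult_1_r, Int_part_div by lia.
  reflexivity.
Qed.

Lemma last_map_seq (A : Type) (f : nat -> A) n (x : A) :
  last (map f (seq 0 (S n))) x = f n.
Proof. rewrite seq_S, map_app. cbn. now rewrite last_last. Qed.

Lemma nth_map_seq (A : Type) (f : nat -> A) n i (x : A) :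
  (i < n)%nat -> nth i (map f (seq 0 n)) x = f i.
Proof.
  intros Hi. rewrite (nth_indep _ x (f i)) by (rewrite length_map, length_seq; auto).
  rewrite map_nth, seq_nth; auto.
Qed.

(** * Formulas over prefix counts and the transformers deciding them *)

Inductive fm : Type :=
| FLet : nat -> fm
| FGe : (nat -> Z) -> fm
| FNot : fm -> fm
| FAnd : fm -> fm -> fm.

Definition total (l : nat -> Z) (w : list nat) : Z := sumZ (map l w).

(* [FLet b]: the current letter is [b]; [FGe l]: the letters of the prefix,
   weighted by [l], have a nonnegative sum. *)
Fixpoint fsem (f : fm) (w : list nat) (a : nat) : bool :=
  match f with
  | FLet b => Nat.eqb a b
  | FGe l => 0 <=? total l w
  | FNot f => negb (fsem f w a)
  | FAnd f g => fsem f w a && fsem g w a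
  end.

Fixpoint atoms (f : fm) : list (nat -> Z) :=
  match f with
  | FLet _ => []
  | FGe l => [l]
  | FNot f => atoms f
  | FAnd f g => atoms f ++ atoms g
  end.

(** The part of the evaluation that a position can do alone: it sees its letter and the signs of the
    atoms, listed in the order of [atoms]. *)
Fixpoint feval (f : fm) (a : nat) (bs : list bool) : bool :=
  match f with
  | FLet b => Nat.eqb a b
  | FGe _ => hd false bs
  | FNot f => negb (feval f a bs)
  | FAnd f g => feval f a (firstn (length (atoms f)) bs)
                && feval g a (skipn (length (atoms f)) bs)
  end.

Lemma feval_fsem f w a :
  feval f a (map (fun l => 0 <=? total l w) (atoms f)) = fsem f w a.
Proof.
  induction f as [b|l|f IH|f IHf g IHg]; cbn; auto.
  - now rewrite IH.
  - rewrite map_app.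
    rewrite firstn_app, firstn_all2, length_map, Nat.sub_diag by now rewrite length_map.
    rewrite skipn_app, skipn_all2, length_map, Nat.sub_diag by now rewrite length_map.
    cbn. now rewrite app_nil_r, IHf, IHg.
Qed.

Definition letter_of (x : list Z) : nat := Z.to_nat (nth 0 x 0).

(* Coordinate 0 carries the letter; coordinates [2 + k] receive the floored
   averages of the atoms, whose signs decide [f]. *)
Definition check_layer (f : fm) (fin : nat -> bool) (K : nat) : layer :=
  let p := S (S K) in
  let m := length (atoms f) in
  uniform_layer (S (S m))
    (fun x => 0 :: 0 :: map (fun l => clampZ p (l (letter_of x))) (atoms f))
    (fun x => (if feval f (letter_of x) (map (Z.leb 0) (skipn 2 x)) then 0 else -1)
              :: (if fin (letter_of x) then 1 else 0) :: zeros m).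

(* Averages the failure marks [-1] found in coordinate 0. *)
Definition collect_layer (f : fm) (K : nat) : layer :=
  let m := length (atoms f) in
  uniform_layer (S (S m))
    (fun x => clampZ (S (S K)) (nth 0 x 0) :: 0 :: zeros m) (fun x => x).

(** With scale 0 the representable numbers are integers, and precision [K + 2] holds all those of
    absolute value at most [K]. The flag for the last letter travels in coordinate 1 through the
    residual connection. *)
Definition fm_transformer (f : fm) (fin : nat -> bool) (K : nat) : transformer :=
  let p := S (S K) in
  let m := length (atoms f) in
  {| tp := p; ts := 0; td := S (S m);
     temb := fun a => clampZ p (Z.of_nat a) :: 0 :: zeros m;
     tlayers := [check_layer f fin K; collect_layer f K];
     tout := fun x => if (0 <=? nth 0 x 0) && (nth 1 x 0 =? 1) then 1 else 0 |}.

Lemma fm_transformer_wf nsym f fin K : wf_transformer nsym (fm_transformer f fin K).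
Proof.
  assert (Hp : (2 <= S (S K))%nat) by lia.
  assert (S1 : forall z, -1 <= z <= 1 -> in_F (S (S K)) z)
    by (intros; apply in_F_small; auto).
  pose proof (in_Fvec_zeros (S (S K)) (length (atoms f)) Hp) as HZ.
  pose proof (in_Fvec_zeros (S (S K)) (S (S (length (atoms f)))) Hp) as HZ2.
  unfold wf_transformer. cbn [tp td temb tlayers tout fm_transformer].
  split; [lia|]. split; [|split].
  - intros a _. apply in_Fvec_cons; [apply clampZ_in_F; lia|].
    apply in_Fvec_cons; auto. apply S1. lia.
  - intros L HL x Hx. destruct HL as [<-|[<-|[]]]; cbn [WQ WK WV FF uniform_layer];
      (split; [exact HZ2|split; [exact HZ2|split]]).
    + apply in_Fvec_cons; [apply S1; lia|]. apply in_Fvec_cons; [apply S1; lia|].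
      split; [apply length_map|]. apply Forall_forall. intros y Hy.
      apply in_map_iff in Hy. destruct Hy as (l & <- & _). apply clampZ_in_F. lia.
    + apply in_Fvec_cons; [apply S1; destruct feval; lia|].
      apply in_Fvec_cons; auto. apply S1; destruct fin; lia.
    + apply in_Fvec_cons; [apply clampZ_in_F; lia|]. apply in_Fvec_cons; auto.
      apply S1. lia.
    + exact Hx.
  - intros x _. apply S1. destruct (_ && _); lia.
Qed.

Definition prefix_ok (f : fm) (w : list nat) (i : nat) : bool :=
  fsem f (firstn (S i) w) (nth i w 0%nat).

Lemma Z_div_nonneg_iff a b : 0 < b -> (0 <= a / b <-> 0 <= a).
Proof.
  intros Hb. split; intros H.
  - assert (E : a = b * (a / b) + a mod b) by (apply Z_div_mod_eq_full).
    pose proof (Z.mod_pos_bound a b Hb). nia.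
  - now apply Z.div_pos.
Qed.

Section Run.
Variables (nsym : nat) (f : fm) (fin : nat -> bool) (K : nat) (w : list nat).
Hypothesis nsym_le : (nsym <= K)%nat.
Hypothesis atoms_bound :
  forall l, In l (atoms f) -> forall a, (a < nsym)%nat -> Z.abs (l a) <= Z.of_nat K.
Hypothesis Hw : word nsym w.

Let p := S (S K).
Let m := length (atoms f).

Lemma in_F_le_K z : Z.abs z <= Z.of_nat K -> in_F p z.
Proof.
  intros Hz. unfold in_F, fp_lo, fp_hi, p.
  assert (Z.of_nat K < 2 ^ Z.of_nat K) by (apply Z.pow_gt_lin_r; lia).
  assert (2 ^ Z.of_nat K <= 2 ^ (Z.of_nat (S (S K)) - 1)) by (apply Z.pow_le_mono_r; lia).
  lia.
Qed.

Lemma letter_lt i : (i < length w)%nat -> (nth i w 0 < nsym)%nat.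
Proof.
  intros Hi. unfold word in Hw. rewrite Forall_forall in Hw. apply Hw. now apply nth_In.
Qed.

Lemma clamp_letter a : (a < nsym)%nat -> clampZ p (Z.of_nat a) = Z.of_nat a.
Proof. intros Ha. apply clampZ_id, in_F_le_K. lia. Qed.

Definition marks (i : nat) : list Z :=
  (if prefix_ok f w i then 0 else -1) ::
  (if fin (nth i w 0%nat) then 1 else 0) :: zeros m.

Lemma first_layer :
  layer_apply p 0 (S (S m)) (check_layer f fin K)
    (map (temb (fm_transformer f fin K)) w)
  = map marks (seq 0 (length w)).
Proof.
  unfold check_layer. fold m. fold p.
  rewrite uniform_layer_apply by (unfold p; lia).
  rewrite length_map. apply map_ext_in. intros i Hi. apply in_seq in Hi.
  destruct Hi as [_ Hi]. cbn in Hi.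
  set (e := temb (fm_transformer f fin K)).
  rewrite (nth_indep _ nil (e 0%nat)) by (rewrite length_map; auto).
  rewrite map_nth, firstn_map.
  set (u := firstn (S i) w). set (a := nth i w 0%nat).
  assert (Hu : forall b, In b u -> (b < nsym)%nat).
  { intros b Hb. unfold word in Hw. rewrite Forall_forall in Hw. apply Hw.
    rewrite <- (firstn_skipn (S i) w). apply in_or_app. now left. }
  assert (Ha : (a < nsym)%nat) by now apply letter_lt.
  assert (Hlet : forall b, (b < nsym)%nat -> letter_of (e b) = b).
  { intros b Hb. unfold letter_of, e. cbn [temb fm_transformer nth]. fold p.
    rewrite clamp_letter by auto. apply Nat2Z.id. }
  cbn [seq map nth].
  set (x := _ :: _ :: map _ (seq 2 m)).
  (* The values vanish in coordinate 0, so the residual connection returns the letter unchanged. *)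
  assert (X0 : letter_of x = a).
  { unfold letter_of, x. cbn [nth].
    rewrite sumZ_const_zero by auto. rewrite Zdiv_0_l.
    rewrite (clampZ_id p 0) by (apply in_F_small; unfold p; lia).
    unfold e. cbn [temb fm_transformer nth]. fold p.
    rewrite !clamp_letter; cbn; auto. rewrite clamp_letter by auto. lia. }
  (* Here the embedding is zero, so the residual adds nothing to the floored average, whose sign is
     that of the exact total. *)
  assert (X2 : map (Z.leb 0) (skipn 2 x) = map (fun l => 0 <=? total l u) (atoms f)).
  { unfold x. cbn [skipn]. rewrite map_map, <- seq_shift, <- seq_shift, !map_map.
    transitivity (map (fun k => 0 <=? total (nth k (atoms f) (fun _ => 0)) u) (seq 0 m)).
    - apply map_ext_in. intros k Hk. apply in_seq in Hk. unfold m in Hk.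
      cbn [nth].
      replace (nth (S (S k)) (e a) 0) with 0 by (symmetry; exact (nth_zeros m k)).
      rewrite Z.add_0_r.
      apply eq_true_iff_eq. rewrite !Z.leb_le.
      rewrite !clampZ_nonneg by (unfold p; lia).
      rewrite Z_div_nonneg_iff by lia.
      rewrite map_map. unfold total.
      rewrite (map_ext_in _ (nth k (atoms f) (fun _ => 0))); [reflexivity|].
      intros b Hb.
      rewrite (nth_indep _ 0 (clampZ p ((fun _ : nat => 0) (letter_of (e b)))))
        by (rewrite length_map; lia).
      etransitivity.
      { exact (map_nth (fun l : nat -> Z => clampZ p (l (letter_of (e b)))) _ (fun _ => 0) k). }
      cbn beta.
      rewrite Hlet by auto. apply clampZ_id, in_F_le_K, atoms_bound; auto.
      apply nth_In. lia.
    - unfold m. clear. induction (atoms f) as [|l ls IH] using rev_ind; auto.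
      rewrite length_app, seq_app, !map_app. cbn [length seq map Nat.add].
      rewrite app_nth2, Nat.sub_diag by lia. f_equal. rewrite <- IH.
      apply map_ext_in. intros k Hk. apply in_seq in Hk. now rewrite app_nth1 by lia. }
  rewrite X0, X2, feval_fsem. reflexivity.
Qed.

(** No mark is positive, so a failure can never be compensated by other positions. *)
Lemma marks_sum n :
  0 <= sumZ (map (fun i => nth 0 (marks i) 0) (seq 0 n)) <->
  forall i, (i < n)%nat -> prefix_ok f w i = true.
Proof.
  assert (A : forall l, sumZ (map (fun i => nth 0 (marks i) 0) l) <= 0).
  { induction l as [|i l IH]; cbn [map sumZ fold_right]; [lia|].
    unfold sumZ in IH. cbn [nth marks]. destruct prefix_ok; cbn [nth marks] in IH; lia. }
  assert (B : forall l, 0 <= sumZ (map (fun i => nth 0 (marks i) 0) l) <->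
    forall i, In i l -> prefix_ok f w i = true).
  { induction l as [|i l IH]; cbn [map sumZ fold_right].
    - split; [intros _ i []|lia].
    - specialize (A l). unfold sumZ in A, IH. cbn [nth marks] in *. split.
      + intros H j [<-|Hj].
        * destruct prefix_ok; auto; lia.
        * apply IH; auto. destruct prefix_ok; lia.
      + intros H. rewrite (H i) by now left.
        assert (0 <= fold_right Z.add 0 (map (fun i0 => if prefix_ok f w i0 then 0 else -1) l));
          [|lia].
        apply IH. intros j Hj. apply H. now right. }
  rewrite B. split; intros H i Hi; apply H; [apply in_seq|apply in_seq in Hi]; lia.
Qed.

Lemma fm_transformer_accepts :
  accepts (fm_transformer f fin K) w <->
  exists n, length w = S n /\ fin (nth n w 0%nat) = true /\
    forall i, (i <= n)%nat -> prefix_ok f w i = true.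
Proof.
  unfold accepts, run.
  change (tlayers (fm_transformer f fin K)) with [check_layer f fin K; collect_layer f K].
  cbn [fold_left].
  change (tp (fm_transformer f fin K)) with p.
  change (ts (fm_transformer f fin K)) with 0.
  change (td (fm_transformer f fin K)) with (S (S m)).
  rewrite first_layer. unfold collect_layer. fold m. fold p.
  rewrite uniform_layer_apply by (unfold p; lia).
  rewrite length_map, length_seq.
  destruct (length w) as [|n] eqn:En.
  { split; [intros [H _]|intros (n & H & _); discriminate].
    apply length_zero_iff_nil in En. contradiction. }
  rewrite last_map_seq, firstn_all2 by (rewrite length_map, length_seq; lia).
  rewrite (nth_map_seq _ marks (S n) n) by lia.
  change (seq 0 (S (S m))) with (0 :: 1 :: seq 2 m)%nat.
  rewrite !map_cons. cbn [tout fm_transformer].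
  set (x := _ :: _ :: map _ (seq 2 m)).
  assert (X1 : nth 1 x 0 = if fin (nth n w 0%nat) then 1 else 0).
  { unfold x. cbn [nth]. rewrite sumZ_const_zero by (intros; reflexivity).
    rewrite Zdiv_0_l, (clampZ_id p 0) by (apply in_F_small; unfold p; lia).
    cbn [nth marks]. apply clampZ_id, in_F_small; [unfold p; lia|destruct fin; lia]. }
  assert (X0 : 0 <= nth 0 x 0 <-> forall i, (i <= n)%nat -> prefix_ok f w i = true).
  { unfold x. cbn [nth]. rewrite clampZ_nonneg by (unfold p; lia).
    rewrite map_map.
    assert (EM : map (fun i => nth 0 (clampZ p (nth 0 (marks i) 0) :: 0 :: zeros m) 0) (seq 0 (S n))
       = map (fun i => nth 0 (marks i) 0) (seq 0 (S n))).
    { apply map_ext. intros i. cbn [nth marks].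
      apply clampZ_id, in_F_small; [unfold p; lia|destruct prefix_ok; lia]. }
    cbn [nth] in EM. rewrite EM. clear EM.
    (* [c] is the floored average of all marks. The residual connection adds the mark of the last
       position, which is at most 0 and already among those averaged. *)
    set (c := clampZ p _).
    assert (Hc : 0 <= c <-> forall i, (i < S n)%nat -> prefix_ok f w i = true).
    { unfold c. rewrite clampZ_nonneg by (unfold p; lia).
      rewrite Z_div_nonneg_iff by lia. apply marks_sum. }
    cbn [nth marks]. split; intros H.
    - intros i Hi. apply Hc; [|lia]. destruct prefix_ok; lia.
    - rewrite (H n) by lia. assert (0 <= c); [|lia]. apply Hc. intros i Hi. apply H. lia. }
  split.
  - intros [_ H]. exists n. split; auto.
    destruct (0 <=? nth 0 x 0) eqn:E0; cbn [andb] in H; [|lia]. apply Z.leb_le in E0.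
    destruct (nth 1 x 0 =? 1) eqn:E1; [|lia]. apply Z.eqb_eq in E1.
    split; [|now apply X0]. rewrite X1 in E1. destruct fin; auto; lia.
  - intros (n' & E & Hf & H). injection E as <-. split.
    + intros ->. discriminate.
    + apply X0 in H. apply Z.leb_le in H. rewrite H, X1, Hf. cbn. reflexivity.
Qed.
End Run.

(** * Words describing runs *)

Definition ladd (l m : nat -> Z) : nat -> Z := fun a => l a + m a.
Definition lscale (k : Z) (l : nat -> Z) : nat -> Z := fun a => k * l a.

Lemma total_ladd l m w : total (ladd l m) w = total l w + total m w.
Proof.
  induction w as [|a w IH]; auto. unfold total in *. cbn [map sumZ fold_right].
  unfold sumZ in IH. rewrite IH. unfold ladd. lia.
Qed.

Lemma total_lscale k l w : total (lscale k l) w = k * total l w.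
Proof.
  induction w as [|a w IH]; [unfold total; cbn; lia|]. unfold total in *.
  cbn [map sumZ fold_right]. unfold sumZ in IH. rewrite IH. unfold lscale. lia.
Qed.

Lemma total_snoc l w a : total l (w ++ [a]) = total l w + l a.
Proof.
  unfold total. induction w as [|b w IH]; cbn [app map sumZ fold_right]; [lia|].
  unfold sumZ in IH. rewrite IH. lia.
Qed.

Definition FOr f g := FNot (FAnd (FNot f) (FNot g)).
Definition FImp f g := FNot (FAnd f (FNot g)).
Definition FEq l m := FAnd (FGe (ladd l (lscale (-1) m))) (FGe (ladd m (lscale (-1) l))).
Definition FLt l m := FNot (FGe (ladd l (lscale (-1) m))).
Definition FLe l m := FGe (ladd m (lscale (-1) l)).

Definition holds (f : fm) (w : list nat) (a : nat) : Prop := fsem f w a = true.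

Lemma holds_let b w a : holds (FLet b) w a <-> a = b.
Proof. apply Nat.eqb_eq. Qed.

Lemma holds_and f g w a : holds (FAnd f g) w a <-> holds f w a /\ holds g w a.
Proof. apply andb_true_iff. Qed.

Lemma holds_not f w a : holds (FNot f) w a <-> ~ holds f w a.
Proof. unfold holds. cbn. destruct (fsem f w a); cbn; intuition congruence. Qed.

Lemma holds_or f g w a : holds (FOr f g) w a <-> holds f w a \/ holds g w a.
Proof.
  unfold holds, FOr. cbn. destruct (fsem f w a), (fsem g w a); cbn; intuition congruence.
Qed.

Lemma holds_imp f g w a : holds (FImp f g) w a <-> (holds f w a -> holds g w a).
Proof.
  unfold holds, FImp. cbn. destruct (fsem f w a), (fsem g w a); cbn; intuition congruence.
Qed.

Lemma holds_eq l m w a : holds (FEq l m) w a <-> total l w = total m w.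
Proof.
  unfold FEq. rewrite holds_and. unfold holds. cbn [fsem].
  rewrite !Z.leb_le, !total_ladd, !total_lscale. lia.
Qed.

Lemma holds_lt l m w a : holds (FLt l m) w a <-> total l w < total m w.
Proof.
  unfold FLt. rewrite holds_not. unfold holds. cbn [fsem].
  rewrite !Z.leb_le, !total_ladd, !total_lscale. lia.
Qed.

Lemma holds_le l m w a : holds (FLe l m) w a <-> total l w <= total m w.
Proof.
  unfold FLe, holds. cbn [fsem]. rewrite !Z.leb_le, !total_ladd, !total_lscale. lia.
Qed.

(* The alphabet: 0 = start, 1 = end, 2 = commit the guessed successor,
   3 = the current configuration has caught up; 4/5, 6/7 increment/decrement the
   current value A and address P; 8/9, 10/11 do so for the guessed successor
   (B, Q) and 12/13 for the quotient C witnessing indivisibility. *)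
Definition one (a : nat) : Z := match a with 0%nat => 1 | _ => 0 end.
Definition other (a : nat) : Z := match a with 0%nat => 0 | _ => 1 end.
Definition ended (a : nat) : Z := match a with 1%nat => 1 | _ => 0 end.
Definition phase (a : nat) : Z := match a with 2%nat => 1 | 3%nat => -1 | _ => 0 end.
(** The start letter counts here too, because the initial memory is 1 and not 0. *)
Definition rA (a : nat) : Z := match a with 0%nat => 1 | 4%nat => 1 | 5%nat => -1 | _ => 0 end.
Definition rP (a : nat) : Z := match a with 6%nat => 1 | 7%nat => -1 | _ => 0 end.
Definition rB (a : nat) : Z := match a with 8%nat => 1 | 9%nat => -1 | _ => 0 end.
Definition rQ (a : nat) : Z := match a with 10%nat => 1 | 11%nat => -1 | _ => 0 end.
Definition rC (a : nat) : Z := match a with 12%nat => 1 | 13%nat => -1 | _ => 0 end.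

Definition zero : nat -> Z := fun _ => 0.

Lemma total_zero w : total zero w = 0.
Proof. now apply sumZ_const_zero. Qed.

(** Constants are multiplied by the count of start letters. Given the guessed quotient [C],
    divisibility of [A] by [p] is the linear equation [p C = A], and indivisibility is
    [p C < A < p C + p]. *)
Definition instr_fm (k : nat) (i : instr) : fm :=
  let next := FEq rQ (lscale (Z.of_nat k + 1) one) in
  match i with
  | IInc r => FAnd (FEq rB (lscale (zprime r) rA)) next
  | IDec r => FAnd (FEq (lscale (zprime r) rB) rA) next
  | IJz r a =>
      FAnd (FEq rB rA)
        (FOr (FAnd (FAnd (FLt (lscale (zprime r) rC) rA)
                         (FLt rA (ladd (lscale (zprime r) rC) (lscale (zprime r) one))))
                   (FEq rQ (lscale (Z.of_nat a) one)))
             (FAnd (FEq (lscale (zprime r) rC) rA) next))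
  | IJmp a => FAnd (FEq rB rA) (FEq rQ (lscale (Z.of_nat a) one))
  end.

Fixpoint step_fm (k : nat) (code : list instr) : fm :=
  match code with
  | [] => FLt zero zero
  | i :: code' =>
      FOr (FAnd (FEq rP (lscale (Z.of_nat k) one)) (instr_fm k i)) (step_fm (S k) code')
  end.

Definition FLets (bs : list nat) : fm :=
  fold_right (fun b f => FOr (FLet b) f) (FLt zero zero) bs.

(* Averages only see homogeneous forms, so the number of start letters plays the
   role of the constant 1.  Start letters form a prefix, and the equality of the
   numbers of start and end letters, checked already at the first end letter,
   forces that number to be 1. *)
Definition run_fm (code : list instr) : fm :=
  FAnd (FLt zero one)
  (FAnd (FImp (FLet 0) (FLe other zero))
  (FAnd (FImp (FLet 1) (FAnd (FEq ended one) (FAnd (FEq phase zero)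
           (FEq rP (lscale (Z.of_nat (length code)) one)))))
  (FAnd (FImp (FLet 2) (FAnd (FEq phase one) (step_fm 0 code)))
  (FAnd (FImp (FLet 3) (FAnd (FEq phase zero) (FAnd (FEq rA rB) (FEq rP rQ))))
  (FAnd (FImp (FLets [4; 5; 6; 7]%nat) (FEq phase one))
        (FImp (FLets [8; 9; 10; 11; 12; 13]%nat) (FEq phase zero))))))).

(** Homogeneous form of [irel], with [o] the number of start letters; at [o = 1] the two agree up to
    the choice of [C]. *)
Definition irelC (i : instr) (o k A Q B C : Z) : Prop :=
  match i with
  | IInc r => B = zprime r * A /\ Q = (k + 1) * o
  | IDec r => zprime r * B = A /\ Q = (k + 1) * o
  | IJz r a => B = A /\
      (((zprime r * C < A /\ A < zprime r * C + zprime r * o) /\ Q = Z.of_nat a * o) \/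
       (zprime r * C = A /\ Q = (k + 1) * o))
  | IJmp a => B = A /\ Q = Z.of_nat a * o
  end.

Lemma holds_instr k i w a : holds (instr_fm k i) w a <->
  irelC i (total one w) (Z.of_nat k) (total rA w) (total rQ w) (total rB w) (total rC w).
Proof.
  destruct i; cbn [instr_fm irelC];
    repeat rewrite ?holds_and, ?holds_or, ?holds_eq, ?holds_lt, ?total_ladd, ?total_lscale;
    reflexivity.
Qed.

Lemma holds_step code w a : forall k0, holds (step_fm k0 code) w a <->
  exists k i, nth_error code k = Some i /\
    total rP w = Z.of_nat (k0 + k) * total one w /\
    irelC i (total one w) (Z.of_nat (k0 + k)) (total rA w) (total rQ w)
      (total rB w) (total rC w).
Proof.
  induction code as [|i code IH]; intros k0; cbn [step_fm].
  - rewrite holds_lt. split; [lia|]. intros ([|k] & i & H & _); discriminate.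
  - rewrite holds_or, holds_and, holds_eq, total_lscale, holds_instr, IH. split.
    + intros [[H1 H2]|(k & j & H & H1 & H2)].
      * exists 0%nat, i. rewrite Nat.add_0_r. auto.
      * exists (S k), j. rewrite Nat.add_succ_r. auto.
    + intros ([|k] & j & H & H1 & H2).
      * injection H as <-. rewrite Nat.add_0_r in *. auto.
      * right. exists k, j. rewrite Nat.add_succ_r in *. auto.
Qed.

Lemma irelC_sound i k A Q B C : irelC i 1 k A Q B C -> irel i k A Q B.
Proof.
  destruct i as [r|r|r a|a]; cbn; rewrite ?Z.mul_1_r; auto.
  pose proof (zprime_ge2 r). intros [-> [[[H1 H2] ->]|[H1 ->]]]; split; auto.
  (* No multiple of the prime lies strictly between the multiples by [C] and by [C + 1]. *)
  - left. split; auto. intros E. apply Z_div_exact_full_2 in E; [|lia].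
    revert E. generalize (A / zprime r). intros q ->.
    apply Z.mul_lt_mono_pos_l in H1; [|lia].
    assert (q < C + 1) by (apply (Z.mul_lt_mono_pos_l (zprime r)); lia). lia.
  - right. split; auto. rewrite <- H1, Z.mul_comm. apply Z_mod_mult.
Qed.

Lemma irelC_complete i k A Q B : irel i k A Q B -> exists C, irelC i 1 k A Q B C.
Proof.
  destruct i as [r|r|r a|a]; cbn; try (exists 0; rewrite ?Z.mul_1_r; auto; fail).
  pose proof (zprime_ge2 r) as Hp. intros [-> H]. exists (A / zprime r).
  pose proof (Z_div_mod_eq_full A (zprime r)) as E.
  pose proof (Z.mod_pos_bound A (zprime r)) as M.
  rewrite !Z.mul_1_r. split; auto. destruct H as [[H ->]|[H ->]].
  - left. split; [lia|auto].
  - right. split; [lia|auto].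
Qed.

(** Totals include the current letter. In phase 0 only [B], [Q], [C] may move and in phase 1 only
    [A], [P], so one of the two configurations is always frozen. *)
Definition guard (code : list instr) (w : list nat) (a : nat) : Prop :=
  0 < total one w /\
  (a = 0%nat -> total other w <= 0) /\
  (a = 1%nat -> total ended w = total one w /\ total phase w = 0 /\
     total rP w = Z.of_nat (length code) * total one w) /\
  (a = 2%nat -> total phase w = total one w /\ exists k i, nth_error code k = Some i /\
     total rP w = Z.of_nat k * total one w /\
     irelC i (total one w) (Z.of_nat k) (total rA w) (total rQ w) (total rB w) (total rC w)) /\
  (a = 3%nat -> total phase w = 0 /\ total rA w = total rB w /\ total rP w = total rQ w) /\
  ((4 <= a <= 7)%nat -> total phase w = total one w) /\
  ((8 <= a <= 13)%nat -> total phase w = 0).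

Lemma holds_lets bs w a : holds (FLets bs) w a <-> In a bs.
Proof.
  induction bs as [|b bs IH]; cbn [FLets fold_right].
  - rewrite holds_lt. split; [lia|intros []].
  - rewrite holds_or, holds_let. unfold FLets in IH. rewrite IH. cbn.
    split; intros [H|H]; auto.
Qed.

Lemma holds_run code w a : holds (run_fm code) w a <-> guard code w a.
Proof.
  unfold run_fm, guard.
  repeat rewrite ?holds_and, ?holds_imp, ?holds_let, ?holds_lets, ?holds_eq, ?holds_lt,
    ?holds_le, ?total_lscale, ?total_zero, ?holds_step.
  cbn [Nat.add In].
  assert (E1 : (4 = a \/ 5 = a \/ 6 = a \/ 7 = a \/ False)%nat <-> (4 <= a <= 7)%nat) by lia.
  assert (E2 : (8 = a \/ 9 = a \/ 10 = a \/ 11 = a \/ 12 = a \/ 13 = a \/ False)%nat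
               <-> (8 <= a <= 13)%nat) by lia.
  rewrite E1, E2. reflexivity.
Qed.

(** * Soundness: valid words follow the machine *)

Inductive valid (code : list instr) : list nat -> Prop :=
| valid_nil : valid code []
| valid_snoc u b : valid code u -> guard code (u ++ [b]) b -> valid code (u ++ [b]).

Lemma valid_iff code w :
  (forall i, (i < length w)%nat -> prefix_ok (run_fm code) w i = true) <-> valid code w.
Proof.
  induction w as [|b w IH] using rev_ind.
  - split; [constructor|intros _ i Hi; cbn in Hi; lia].
  - assert (L : prefix_ok (run_fm code) (w ++ [b]) (length w) = true
                <-> guard code (w ++ [b]) b).
    { rewrite <- holds_run. unfold prefix_ok, holds.
      rewrite firstn_all2 by (rewrite length_app; cbn; lia).
      now rewrite nth_middle. }
    assert (E : forall i, (i < length w)%nat ->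
      prefix_ok (run_fm code) (w ++ [b]) i = prefix_ok (run_fm code) w i).
    { intros i Hi. unfold prefix_ok. rewrite firstn_app, app_nth1 by auto.
      replace (S i - length w)%nat with 0%nat by lia. cbn [firstn]. now rewrite app_nil_r. }
    rewrite length_app. cbn [length]. split.
    + intros H. constructor.
      * apply IH. intros i Hi. rewrite <- E by auto. apply H. lia.
      * apply L, H. lia.
    + intros H. inversion H as [H0|u c Hu Hg E0]; [now destruct w|].
      apply app_inj_tail in E0. destruct E0 as [-> ->].
      intros i Hi. destruct (Nat.eq_dec i (length w)) as [->|Hne].
      * now apply L.
      * rewrite E by lia. apply IH; [auto|lia].
Qed.

Lemma total_nonneg l w : (forall a, 0 <= l a) -> 0 <= total l w.
Proof.
  intros H. unfold total. induction w as [|a w IH]; cbn [map sumZ fold_right]; [lia|].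
  specialize (H a). unfold sumZ in IH. lia.
Qed.

Lemma one_other_nil u : total one u <= 0 -> total other u <= 0 -> u = [].
Proof.
  intros H1 H2. destruct u as [|a u]; auto. exfalso.
  assert (0 <= total one u) by (apply total_nonneg; intros [|b]; cbn; lia).
  assert (0 <= total other u) by (apply total_nonneg; intros [|b]; cbn; lia).
  unfold total, sumZ in *. cbn [map fold_right] in *. destruct a; cbn [one other] in *; lia.
Qed.

Lemma total_rA_le u : total rA u <= Z.of_nat (length u).
Proof.
  induction u as [|a u IH] using rev_ind; [cbn; lia|].
  rewrite total_snoc, length_app. cbn [length].
  assert (rA a <= 1) by (do 6 (destruct a as [|a]; [cbn; lia|]); cbn; lia).
  lia.
Qed.

Definition reachable (code : list instr) (P A : Z) : Prop :=
  zsteps code (0, 1) (P, A).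

Lemma ended_nonneg u : 0 <= total ended u.
Proof. apply total_nonneg. intros [|[|b]]; cbn; lia. Qed.

Lemma zsteps_snoc code x y z : zsteps code x y -> zstep code y z -> zsteps code x z.
Proof. intros H H'. eapply zsteps_trans; eauto. now apply zsteps_one. Qed.

Lemma valid_invariant code u : valid code u -> Forall (fun a => (a < 14)%nat) u ->
  total ended u = 0 -> total one u = 1 ->
  (total phase u = 0 /\ reachable code (total rP u) (total rA u)) \/
  (total phase u = 1 /\ reachable code (total rQ u) (total rB u)).
Proof.
  induction 1 as [|u b Hu IH Hg]; intros Hw He Ho; [discriminate|].
  apply Forall_app in Hw. destruct Hw as [Hw Hb]. inversion Hb as [|? ? Hb' _]; subst.
  destruct Hg as (G1 & G2 & G3 & G4 & G5 & G6 & G7).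
  rewrite !total_snoc in *.
  pose proof (ended_nonneg u) as Hn.
  destruct b as [|b].
  (* Only start letters may precede a start letter, and just one is counted, so [u] is empty and the
     configuration is the initial one. *)
  { specialize (G2 eq_refl). cbn [one other] in *.
    rewrite (one_other_nil u) by lia. left. split; [reflexivity|constructor]. }
  destruct b as [|b].
  { cbn [ended] in He. lia. }
  assert (He' : total ended u = 0) by (cbn [ended] in He; lia).
  assert (Ho' : total one u = 1) by (cbn [one] in Ho; lia).
  specialize (IH Hw He' Ho').
  destruct b as [|b].
  { destruct (G4 eq_refl) as (F1 & k & i & Hk & HP & HR).
    cbn [one phase rP rA rB rQ rC] in *. rewrite Ho', !Z.add_0_r in *.
    right. split; [lia|]. destruct IH as [[_ IH]|[IH _]]; [|lia].
    eapply zsteps_snoc; [exact IH|]. exists k, i. cbn. split; auto. split; [lia|].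
    eapply irelC_sound; eauto. }
  destruct b as [|b].
  { destruct (G5 eq_refl) as (F1 & HA & HP).
    cbn [one phase rP rA rB rQ rC] in *. rewrite !Z.add_0_r in *.
    left. split; [lia|]. destruct IH as [[IH _]|[_ IH]]; [lia|]. now rewrite HP, HA. }
  (* The letter is now [b + 4]: up to 7 it moves only [(P, A)], beyond that only the guess. *)
  destruct (Nat.le_gt_cases b 3) as [Hb3|Hb3].
  { assert (F1 : total phase u + 0 = 1) by (rewrite <- Ho; apply G6; lia).
    right. destruct IH as [[IH _]|[_ IH]]; [lia|].
    do 4 (destruct b as [|b];
      [cbn [phase rQ rB]; rewrite !Z.add_0_r in *; split; [lia|exact IH]|]). lia. }
  assert (F1 : total phase u + phase (S (S (S (S b)))) = 0) by (apply G7; lia).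
  left. cbn [phase] in F1. destruct IH as [[_ IH]|[IH _]]; [|lia].
  do 4 (destruct b as [|b]; [lia|]).
  cbn [phase rP rA]. rewrite !Z.add_0_r in *. auto.
Qed.

(** At the first end letter the count of end letters is 1, so its guard yields exactly one start
    letter, as [valid_invariant] requires. The rest of the word can only add length. *)
Lemma first_end code w : valid code w -> Forall (fun a => (a < 14)%nat) w ->
  0 < total ended w ->
  exists u, valid code u /\ Forall (fun a => (a < 14)%nat) u /\ total ended u = 0 /\
    guard code (u ++ [1%nat]) 1 /\ (length u < length w)%nat.
Proof.
  induction 1 as [|u b Hu IH Hg]; intros Hw He; [discriminate|].
  apply Forall_app in Hw. destruct Hw as [Hw _].
  rewrite length_app. cbn [length].
  pose proof (ended_nonneg u) as Hn.
  destruct (Z.eq_dec (total ended u) 0) as [E|E].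
  - rewrite total_snoc in He.
    assert (b = 1%nat) as -> by (destruct b as [|[|b]]; cbn [ended] in He; lia).
    exists u. split; [|split; [|split; [|split]]]; auto; lia.
  - destruct IH as (v & V1 & V2 & V3 & V4 & V5); auto; [lia|].
    exists v. split; [|split; [|split; [|split]]]; auto; lia.
Qed.

(** A letter raises [A] by at most 1, so the prefix before the first end letter already has at least
    as many letters as the final memory. *)
Lemma valid_sound code w N : valid code w -> Forall (fun a => (a < 14)%nat) w ->
  0 < total ended w ->
  zsteps code (0, 1) (Z.of_nat (length code), N) -> N < Z.of_nat (length w).
Proof.
  intros Hv Hw He HN.
  destruct (first_end code w Hv Hw He) as (u & V1 & V2 & V3 & V4 & V5).
  destruct V4 as (_ & _ & G3 & _). destruct (G3 eq_refl) as (E1 & E2 & E3).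
  rewrite !total_snoc in *. cbn [ended one phase rP] in *. rewrite V3, !Z.add_0_r in *.
  cbn in E1. rewrite <- E1 in E3.
  destruct (valid_invariant code u V1 V2 V3 (eq_sym E1)) as [[_ R]|[R _]]; [|lia].
  rewrite E3, Z.mul_1_r in R.
  rewrite (zsteps_halt_unique _ _ _ _ HN R).
  pose proof (total_rA_le u). lia.
Qed.

(** * Completeness: halting runs have valid words *)

Definition state (code : list instr) (u : list nat) (F P A Q B C : Z) : Prop :=
  valid code u /\ Forall (fun a => (a < 14)%nat) u /\
  total one u = 1 /\ total ended u = 0 /\ total phase u = F /\
  total rP u = P /\ total rA u = A /\ total rQ u = Q /\ total rB u = B /\ total rC u = C.

Ltac snoc_state :=
  match goal with
  | H : state _ _ _ _ _ _ _ _ |- state _ _ _ _ _ _ _ _ =>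
      destruct H as (H1 & H2 & H3 & H4 & H5 & H6 & H7 & H8 & H9 & H10);
      split; [constructor; [exact H1|]
             |split; [apply Forall_app; split; [exact H2|repeat constructor]|]];
      unfold guard; rewrite !total_snoc; cbn [one other ended phase rP rA rQ rB rC];
      repeat split; try (intros; lia); try lia
  end.

Lemma state_P_inc code u P A Q B C :
  state code u 1 P A Q B C -> state code (u ++ [6%nat]) 1 (P + 1) A Q B C.
Proof. intros H. snoc_state. Qed.

Lemma state_P_dec code u P A Q B C :
  state code u 1 P A Q B C -> state code (u ++ [7%nat]) 1 (P - 1) A Q B C.
Proof. intros H. snoc_state. Qed.

Lemma state_A_inc code u P A Q B C :
  state code u 1 P A Q B C -> state code (u ++ [4%nat]) 1 P (A + 1) Q B C.
Proof. intros H. snoc_state. Qed.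

Lemma state_A_dec code u P A Q B C :
  state code u 1 P A Q B C -> state code (u ++ [5%nat]) 1 P (A - 1) Q B C.
Proof. intros H. snoc_state. Qed.

Lemma state_Q_inc code u P A Q B C :
  state code u 0 P A Q B C -> state code (u ++ [10%nat]) 0 P A (Q + 1) B C.
Proof. intros H. snoc_state. Qed.

Lemma state_Q_dec code u P A Q B C :
  state code u 0 P A Q B C -> state code (u ++ [11%nat]) 0 P A (Q - 1) B C.
Proof. intros H. snoc_state. Qed.

Lemma state_B_inc code u P A Q B C :
  state code u 0 P A Q B C -> state code (u ++ [8%nat]) 0 P A Q (B + 1) C.
Proof. intros H. snoc_state. Qed.

Lemma state_B_dec code u P A Q B C :
  state code u 0 P A Q B C -> state code (u ++ [9%nat]) 0 P A Q (B - 1) C.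
Proof. intros H. snoc_state. Qed.

Lemma state_C_inc code u P A Q B C :
  state code u 0 P A Q B C -> state code (u ++ [12%nat]) 0 P A Q B (C + 1).
Proof. intros H. snoc_state. Qed.

Lemma state_C_dec code u P A Q B C :
  state code u 0 P A Q B C -> state code (u ++ [13%nat]) 0 P A Q B (C - 1).
Proof. intros H. snoc_state. Qed.

Lemma Z_walk (R : Z -> Prop) :
  (forall z, R z -> R (z + 1)) -> (forall z, R z -> R (z - 1)) ->
  forall x y, R x -> R y.
Proof.
  intros Hi Hd x y Hx.
  assert (A : forall n : nat, R (x + Z.of_nat n) /\ R (x - Z.of_nat n)).
  { induction n as [|n [IH1 IH2]].
    - now rewrite Z.add_0_r, Z.sub_0_r.
    - apply Hi in IH1. apply Hd in IH2. split.
      + now replace (x + Z.of_nat (S n)) with (x + Z.of_nat n + 1) by lia.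
      + now replace (x - Z.of_nat (S n)) with (x - Z.of_nat n - 1) by lia. }
  destruct (Z.le_ge_cases x y) as [H|H].
  - replace y with (x + Z.of_nat (Z.to_nat (y - x))) by lia. apply A.
  - replace y with (x - Z.of_nat (Z.to_nat (x - y))) by lia. apply A.
Qed.

(** The guards of letters 8 to 13 do not look at the guessed counters, so unit steps lead to any
    target, negative values included. *)
Lemma state_guess code P A Q B C : (exists u, state code u 0 P A Q B C) ->
  forall Q' B' C', exists u, state code u 0 P A Q' B' C'.
Proof.
  intros H Q' B' C'.
  apply (Z_walk (fun z => exists u, state code u 0 P A Q' B' z)) with C.
  1,2: intros z [u Hu]; eexists; eauto using state_C_inc, state_C_dec.
  apply (Z_walk (fun z => exists u, state code u 0 P A Q' z C)) with B.
  1,2: intros z [u Hu]; eexists; eauto using state_B_inc, state_B_dec.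
  apply (Z_walk (fun z => exists u, state code u 0 P A z B C)) with Q; auto.
  1,2: intros z [u Hu]; eexists; eauto using state_Q_inc, state_Q_dec.
Qed.

Lemma state_update code P A Q B C : (exists u, state code u 1 P A Q B C) ->
  forall P' A', exists u, state code u 1 P' A' Q B C.
Proof.
  intros H P' A'.
  apply (Z_walk (fun z => exists u, state code u 1 P' z Q B C)) with A.
  1,2: intros z [u Hu]; eexists; eauto using state_A_inc, state_A_dec.
  apply (Z_walk (fun z => exists u, state code u 1 z A Q B C)) with P; auto.
  1,2: intros z [u Hu]; eexists; eauto using state_P_inc, state_P_dec.
Qed.

Lemma state_step code P A Q B : zstep code (P, A) (Q, B) ->
  (exists u Q0 B0 C0, state code u 0 P A Q0 B0 C0) ->
  exists u Q0 B0 C0, state code u 0 Q B Q0 B0 C0.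
Proof.
  intros (k & i & Hk & HP & HR) (u & Q0 & B0 & C0 & H). cbn in HP, HR.
  apply irelC_complete in HR. destruct HR as [C HR].
  destruct (state_guess code P A Q0 B0 C0) with (Q' := Q) (B' := B) (C' := C) as [u1 Hu1];
    [now exists u|].
  assert (Hu2 : state code (u1 ++ [2%nat]) 1 P A Q B C).
  { clear H. snoc_state. exists k, i. split; auto. rewrite H3, H6, H7, H8, H9, H10.
    rewrite !Z.add_0_r, Z.mul_1_r. auto. }
  destruct (state_update code P A Q B C) with (P' := Q) (A' := B) as [u3 Hu3];
    [now exists (u1 ++ [2%nat])|].
  exists (u3 ++ [3%nat]), Q, B, C.
  clear - Hu3. snoc_state.
Qed.

Lemma state_steps code x y : zsteps code x y ->
  (exists u Q0 B0 C0, state code u 0 (fst x) (snd x) Q0 B0 C0) ->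
  exists u Q0 B0 C0, state code u 0 (fst y) (snd y) Q0 B0 C0.
Proof.
  induction 1 as [x|[P A] [Q B] z Hs H IH]; auto.
  intros Hx. apply IH. cbn in *. eapply state_step; eauto.
Qed.

Lemma valid_complete code N : zsteps code (0, 1) (Z.of_nat (length code), N) ->
  exists u, valid code (u ++ [1%nat]) /\ Forall (fun a => (a < 14)%nat) (u ++ [1%nat]).
Proof.
  intros H. apply state_steps in H.
  - destruct H as (u & Q0 & B0 & C0 & H1 & H2 & H3 & H4 & H5 & H6 & _). cbn in H6.
    exists u. split.
    + constructor; auto. unfold guard. rewrite !total_snoc.
      cbn [one other ended phase rP rA rQ rB rC]. repeat split; intros; lia.
    + apply Forall_app. split; auto. repeat constructor.
  - exists [0%nat], 0, 0, 0. cbn. split.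
    + apply (valid_snoc code [] 0); [constructor|].
      unfold guard. cbn. repeat split; intros; lia.
    + repeat split. repeat constructor.
Qed.

(** * Bounds on the weights and the number of atoms *)

Definition bounded (K : Z) (l : nat -> Z) : Prop := forall a, Z.abs (l a) <= K.

Lemma bounded_weaken K K' l : bounded K l -> K <= K' -> bounded K' l.
Proof. intros H HK a. specialize (H a). lia. Qed.

Lemma bounded_ladd K K' l m : bounded K l -> bounded K' m -> bounded (K + K') (ladd l m).
Proof. intros H H' a. specialize (H a). specialize (H' a). unfold ladd. lia. Qed.

Lemma bounded_lscale c K l : bounded K l -> bounded (Z.abs c * K) (lscale c l).
Proof. intros H a. specialize (H a). unfold lscale. rewrite Z.abs_mul. nia. Qed.

Lemma bounded_letters :
  bounded 0 zero /\ bounded 1 one /\ bounded 1 other /\ bounded 1 ended /\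
  bounded 1 phase /\ bounded 1 rA /\ bounded 1 rP /\ bounded 1 rB /\ bounded 1 rQ /\
  bounded 1 rC.
Proof.
  repeat split; intros a; do 14 (destruct a as [|a]; [cbn; lia|]); cbn; lia.
Qed.

Definition fbounded (K : Z) (f : fm) : Prop := Forall (bounded K) (atoms f).

Lemma fbounded_and K f g : fbounded K f -> fbounded K g -> fbounded K (FAnd f g).
Proof. intros. apply Forall_app. auto. Qed.

Lemma fbounded_or K f g : fbounded K f -> fbounded K g -> fbounded K (FOr f g).
Proof. intros. apply Forall_app. auto. Qed.

Lemma fbounded_imp K f g : fbounded K f -> fbounded K g -> fbounded K (FImp f g).
Proof. intros. apply Forall_app. auto. Qed.

Lemma fbounded_let K b : fbounded K (FLet b).
Proof. constructor. Qed.

Lemma fbounded_eq K K1 K2 l m : bounded K1 l -> bounded K2 m -> K1 + K2 <= K ->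
  fbounded K (FEq l m).
Proof.
  intros H1 H2 HK. pose proof (bounded_lscale (-1) _ _ H1).
  pose proof (bounded_lscale (-1) _ _ H2).
  repeat constructor; (eapply bounded_weaken; [apply bounded_ladd; eassumption|lia]).
Qed.

Lemma fbounded_lt K K1 K2 l m : bounded K1 l -> bounded K2 m -> K1 + K2 <= K ->
  fbounded K (FLt l m).
Proof.
  intros H1 H2 HK. pose proof (bounded_lscale (-1) _ _ H2).
  repeat constructor; (eapply bounded_weaken; [apply bounded_ladd; eassumption|lia]).
Qed.

Lemma fbounded_le K K1 K2 l m : bounded K1 l -> bounded K2 m -> K1 + K2 <= K ->
  fbounded K (FLe l m).
Proof.
  intros H1 H2 HK. pose proof (bounded_lscale (-1) _ _ H1).
  repeat constructor; (eapply bounded_weaken; [apply bounded_ladd; eassumption|lia]).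
Qed.

Ltac fbound :=
  destruct bounded_letters as (? & ? & ? & ? & ? & ? & ? & ? & ? & ?);
  repeat lazymatch goal with
    | |- fbounded _ (FAnd _ _) => apply fbounded_and
    | |- fbounded _ (FOr _ _) => apply fbounded_or
    | |- fbounded _ (FImp _ _) => apply fbounded_imp
    | |- fbounded _ (FLet _) => apply fbounded_let
    | |- fbounded _ (FEq _ _) => eapply fbounded_eq
    | |- fbounded _ (FLt _ _) => eapply fbounded_lt
    | |- fbounded _ (FLe _ _) => eapply fbounded_le
    | |- bounded _ (ladd _ _) => apply bounded_ladd
    | |- bounded _ (lscale _ _) => apply bounded_lscale
    | |- bounded _ _ => eassumption
    end;
  try (unfold zprime; lia).

(** The term [2 K] comes from comparing [A] with [p C + p], where both coefficients may be [K]. The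
    slack 14 lets the same bound also cover the letters, which are embedded as numbers. *)
Lemma fbounded_step K code : Forall (instr_bound K) code ->
  forall k, (k + length code <= K)%nat ->
  fbounded (2 * Z.of_nat K + 14) (step_fm k code).
Proof.
  induction 1 as [|i code Hi Hc IH]; intros k Hk; cbn [step_fm].
  - fbound.
  - cbn [length] in Hk. apply fbounded_or; [apply fbounded_and|apply IH; lia].
    + fbound.
    + destruct i; cbn [instr_fm]; cbn in Hi; fbound.
Qed.

Lemma fbounded_run K code : Forall (instr_bound K) code -> (length code <= K)%nat ->
  fbounded (2 * Z.of_nat K + 14) (run_fm code).
Proof.
  intros H HK. pose proof (fbounded_step K code H 0%nat HK) as HS.
  unfold run_fm, FLets. cbn [fold_right].
  apply fbounded_and; [fbound|]. apply fbounded_and; [fbound|].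
  apply fbounded_and; [fbound|]. apply fbounded_and; [|fbound].
  apply fbounded_imp; [fbound|]. apply fbounded_and; [fbound|exact HS].
Qed.

(** [IJz] is the worst case with ten atoms, an equation counting as two; two more compare the
    address. *)
Lemma atoms_step_le code : forall k, (length (atoms (step_fm k code)) <= 12 * length code + 1)%nat.
Proof.
  induction code as [|i code IH]; intros k; [cbn; lia|].
  specialize (IH (S k)). cbn [step_fm FOr atoms FEq]. rewrite !length_app.
  assert (length (atoms (instr_fm k i)) <= 10)%nat by (destruct i; cbn; lia).
  cbn [length]. lia.
Qed.

Lemma atoms_run_le code : (length (atoms (run_fm code)) <= 12 * length code + 40)%nat.
Proof.
  pose proof (atoms_step_le code 0%nat). unfold run_fm.
  cbn [atoms FImp FEq FLt FLe FLets FOr fold_right]. rewrite !length_app. cbn [length]. lia.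
Qed.

(** * The diagonal argument *)

Definition program_size (f : prf) (n : nat) : nat := csize (program f n).

Definition program_transformer (f : prf) (n : nat) (fin : nat -> bool) : transformer :=
  fm_transformer (run_fm (compile 0 (program f n))) fin (2 * program_size f n + 14).

Lemma program_transformer_accepts f n fin w : word 14 w ->
  accepts (program_transformer f n fin) w <->
  valid (compile 0 (program f n)) w /\ exists u a, w = u ++ [a] /\ fin a = true.
Proof.
  intros Hw. unfold program_transformer.
  rewrite fm_transformer_accepts with (nsym := 14%nat); auto; try lia.
  - rewrite <- valid_iff. split.
    + intros (m & E & Hf & H). split; [intros i Hi; apply H; lia|].
      destruct (exists_last (l := w)) as (u & a & ->); [intros ->; discriminate|].
      exists u, a. split; auto. rewrite length_app in E. cbn in E.
      replace m with (length u) in Hf by lia. now rewrite nth_middle in Hf.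
    + intros (H & u & a & -> & Hf). exists (length u). rewrite length_app in *. cbn in *.
      split; [lia|]. split; [now rewrite nth_middle|]. intros i Hi. apply H. lia.
  - intros l Hl a _.
    pose proof (compile_bound (program f n) 0) as HB. cbn [Nat.add] in HB.
    assert (HF : fbounded (2 * Z.of_nat (program_size f n) + 14)
                   (run_fm (compile 0 (program f n)))).
    { apply fbounded_run; auto. rewrite length_compile. apply clen_le_csize. }
    unfold fbounded in HF. rewrite Forall_forall in HF. specialize (HF l Hl a). lia.
Qed.

(** Independent of [f]: if the compiled code has size at most [n], the program has size at most
    [n * (reg_prime 0 + 2)]. The constants are [14 + 2] from the precision and [40 + 2] from the
    dimension. *)
Definition size_limit (n : nat) : nat :=
  size_bound 14 2 (n * (2 * S (S (reg_prime 0))) + 16) 0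
                  (n * (12 * S (S (reg_prime 0))) + 42).

Lemma program_transformer_size f n fin :
  (csize (compile_prf f [0%nat] 1 2) <= n)%nat ->
  (tsize 14 (program_transformer f n fin) <= size_limit n)%nat.
Proof.
  intros Hn. unfold program_transformer.
  set (T := fm_transformer _ _ _).
  assert (Hwf : wf_transformer 14 T) by apply fm_transformer_wf.
  assert (Hs : (program_size f n <= n * S (S (reg_prime 0)))%nat).
  { unfold program_size, program. rewrite csize_set_input. lia. }
  assert (Hl : (length (compile 0 (program f n)) <= program_size f n)%nat).
  { rewrite length_compile. apply clen_le_csize. }
  pose proof (atoms_run_le (compile 0 (program f n))) as Ha.
  eapply Nat.le_trans; [apply tsize_le; exact Hwf|].
  apply size_bound_mono; cbn [tp td T fm_transformer]; lia.
Qed.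

Lemma computable_size_limit : computable size_limit.
Proof.
  apply computable_size_bound;
    (apply computable_add; [apply computable_mul; [apply computable_id|]|];
     apply computable_const).
Qed.

(* Depth-two transformers (over some finite alphabet {0..nsym-1}) do not
   admit non-asymptotic length generalization. *)
Theorem theorem5p1 :
  exists nsym : nat, ~ admits_nonasymptotic_length_generalization nsym 2.
Proof.
  exists 14%nat. intros (g & Hg & Hbound).
  destruct (computable_comp g size_limit Hg computable_size_limit) as [f Hf].
  (* [f] is fixed before its input, so the input can be the size of its own code; this is the least
     choice for which [size_limit n] bounds the transformers. *)
  set (n := csize (compile_prf f [0%nat] 1 2)).
  destruct (program_halts f n _ (Hf n)) as (N & HN & Hrun).
  destruct (valid_complete _ _ Hrun) as (u & Hu & Hw).
  (* The second transformer has no final letter and rejects every word, so the difference is the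
     whole language of the first. *)
  destruct (Hbound (size_limit n) (program_transformer f n (Nat.eqb 1))
              (program_transformer f n (fun _ => false)))
    as (w & Hw' & Hacc & _ & Hlen);
    try apply fm_transformer_wf; try apply program_transformer_size; try reflexivity; auto.
  - exists (u ++ [1%nat]). split; [exact Hw|]. split.
    + apply program_transformer_accepts; auto. split; [exact Hu|].
      now exists u, 1%nat.
    + rewrite program_transformer_accepts by exact Hw. intros [_ (? & ? & _ & H)].
      discriminate.
  - rewrite program_transformer_accepts in Hacc by exact Hw'.
    destruct Hacc as (Hv & v & a & -> & Ha). apply Nat.eqb_eq in Ha. subst a.
    assert (He : 0 < total ended (v ++ [1%nat])).
    { rewrite total_snoc. pose proof (ended_nonneg v). cbn [ended]. lia. }
    pose proof (valid_sound _ _ _ Hv Hw' He Hrun). lia.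
Qed.
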